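(* There exist (infinite dimensional) Banach spaces that are asymptotically symmetric and have no infinite dimensional (closed) subspace that is asymptotic-$\ell_p$, for any $1\le p<\infty$, or asymptotic-$c_0$.
   Context: A Banach space $X$ is asymptotically symmetric if there is $C>0$ such that for all $l\in\mathbb N$, all bounded arrays of sequences $(x^{(i)}_j)_j$, $1\le i\le l$, in $X$, and all permutations $\sigma$ of $\{1,\dots,l\}$, $$\lim_{j_1\to\infty}\cdots\lim_{j_l\to\infty}\Big\|\sum_{i=1}^lx^{(i)}_{j_i}\Big\|\le C\lim_{j_{\sigma(1)}\to\infty}\cdots\lim_{j_{\sigma(l)}\to\infty}\Big\|\sum_{i=1}^lx^{(i)}_{j_i}\Big\|$$ provided both iterated limits exist. A Banach space $Z$ is asymptotic-$\ell_p$ (coordinate free; for asymptotic-$c_0$ replace $\ell_p^n$ by $\ell_\infty^n$) if there is $C$ such that for every $n\in\mathbb N$ player (S) has a winning strategy in the following $n$-turn game: in turn $k$ player (S) picks a finite codimensional subspace $Y_k$ of $Z$ and then player (V) picks a normalized $y_k\in Y_k$; (S) wins if $(y_k)_{k=1}^n$ is $C$-equivalent to the unit vector basis of $\ell_p^n$. Two sequences $(x_i)$, $(y_i)$ are $C$-equivalent if there are $A,B>0$ with $AB\le C$ and $\frac1A\|\sum a_ix_i\|\le\|\sum a_iy_i\|\le B\|\sum a_ix_i\|$ for all scalars. *)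

(* Defs.v *)
From HB Require Import structures.
From mathcomp Require Import all_boot all_order all_algebra all_fingroup.
From mathcomp Require Import all_classical all_reals all_analysis.

Set Implicit Arguments.
Unset Strict Implicit.
Unset Printing Implicit Defensive.

Import Order.TTheory GRing.Theory Num.Theory.
Import numFieldNormedType.Exports.

Local Open Scope classical_set_scope.
Local Open Scope ring_scope.

(* Banach spaces are over the real scalars: X : completeNormedModType R with
   R : realType.  Subspaces are represented by their carriers in X. *)

Definition closed_subspace (R : realType) (X : normedModType R) (Y : set X) :
    Prop :=
  submod_closed (mem Y) /\ closed Y.

Definition finite_dimensional (R : realType) (X : normedModType R)
    (Y : set X) : Prop :=
  exists n (v : 'I_n -> X), (forall i, Y (v i)) /\
    forall y, Y y -> exists a : 'I_n -> R, y = \sum_(i < n) a i *: v i.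

Definition infinite_dimensional (R : realType) (X : normedModType R)
    (Y : set X) : Prop :=
  ~ finite_dimensional Y.

(* The last clause says that the quotient Z / Y is spanned by finitely many
   classes. *)
Definition finite_codim_subspace (R : realType) (X : normedModType R)
    (Z Y : set X) : Prop :=
  [/\ closed_subspace Y, Y `<=` Z &
    exists n (v : 'I_n -> X), (forall i, Z (v i)) /\
      forall z, Z z -> exists a : 'I_n -> R, Y (z - \sum_(i < n) a i *: v i)].

(* lim_{j_(s_0)} lim_{j_(s_1)} ... F j = L, all the limits involved existing.
   The head of s is the outermost limit, and j gives the values of the indices
   not occurring in s. *)
Fixpoint is_iterated_lim (R : realType) (I : eqType) (s : seq I)
    (F : (I -> nat) -> R) (j : I -> nat) (L : R) : Prop :=
  if s is i :: s' then
    exists g : nat -> R,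
      (forall m, is_iterated_lim s' F [eta j with i |-> m] (g m)) /\
      g m @[m --> \oo] --> L
  else F j = L.

(* The initial assignment (fun=> 0%N) is irrelevant: both enumerations of
   'I_l overwrite every index. *)
Definition asymptotically_symmetric (R : realType) (X : normedModType R) :
    Prop :=
  exists2 C : R, 0 < C &
    forall (l : nat) (x : 'I_l -> nat -> X) (sigma : 'S_l) (L L' : R),
      (forall i, bounded_set (range (x i))) ->
      let F (j : 'I_l -> nat) := `| \sum_(i < l) x i (j i) | in
      is_iterated_lim (enum 'I_l) F (fun=> 0%N) L ->
      is_iterated_lim [seq sigma i | i <- enum 'I_l] F (fun=> 0%N) L' ->
      L <= C * L'.

(* C-equivalence of x_1, ..., x_n and y_1, ..., y_n, the norms of the two
   ambient spaces being passed explicitly. *)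
Definition C_equivalent (R : realType) (V W : lmodType R)
    (normV : V -> R) (normW : W -> R) (n : nat)
    (x : 'I_n -> V) (y : 'I_n -> W) (C : R) : Prop :=
  exists A B : R, [/\ 0 < A, 0 < B, A * B <= C &
    forall a : 'I_n -> R,
      A^-1 * normV (\sum_(i < n) a i *: x i) <=
        normW (\sum_(i < n) a i *: y i) <=
      B * normV (\sum_(i < n) a i *: x i)].

Definition lp_norm (R : realType) (p : R) (n : nat) (a : 'rV[R]_n) : R :=
  (\sum_(i < n) `| a 0 i | `^ p) `^ p^-1.

Definition linfty_norm (R : realType) (n : nat) (a : 'rV[R]_n) : R :=
  \big[Num.max/0]_(i < n) `| a 0 i |.

Definition unit_vector_basis (R : realType) (n : nat) (i : 'I_n) : 'rV[R]_n :=
  delta_mx 0 i.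

(* A strategy of (S) maps the history of the moves of (V) to the subspace that
   (S) plays next; it is winning if (S) wins against every legal play y of (V).
   (S) aims at a sequence C-equivalent to the unit vector basis of R^n equipped
   with normE. *)
Definition S_has_winning_strategy (R : realType) (X : normedModType R)
    (Z : set X) (n : nat) (normE : 'rV[R]_n -> R) (C : R) : Prop :=
  exists S : seq X -> set X,
    (forall h, finite_codim_subspace Z (S h)) /\
    forall y : n.-tuple X,
      (forall k : 'I_n, S (take k y) (tnth y k) /\ `| tnth y k | = 1) ->
      C_equivalent Num.norm normE (tnth y) (@unit_vector_basis R n) C.

Definition asymptotic_lp (R : realType) (X : normedModType R) (p : R)
    (Z : set X) : Prop :=
  exists C : R, forall n, S_has_winning_strategy Z (@lp_norm R p n) C.

Definition asymptotic_c0 (R : realType) (X : normedModType R) (Z : set X) :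
    Prop :=
  exists C : R, forall n, S_has_winning_strategy Z (@linfty_norm R n) C.

(* Main.v *)
Require Import Defs.
From HB Require Import structures.
From mathcomp Require Import all_boot all_order all_algebra all_fingroup.
From mathcomp Require Import all_classical all_reals all_analysis.
From mathcomp Require Import zify ring lra.

(** The space consists of all real sequences on which a certain family of
    finitely supported functionals is bounded, normed by the supremum over that
    family.  The family is generated from the multiples of the coordinate
    functionals by scalars in [[-1, 1]] by one operation.  Call average of size
    [t] a functional [(f_1 + ... + f_k) / t] where [k <= t] and [f_1, ..., f_k]
    are successive members of the family.
    A sum [h = a_1 + ... + a_d] of successive averages is again in the family
    when [a_1] has size at least 2, each [a_(j+1)] has size at least the end of
    the support of [a_j], and [d] is less than the beginning of the support of
    [h] (the condition of Schreier).  Spaces of this type, in which all subspaces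
    have both [l_1] and [c_0] spreading models, go back to Argyros, Beanland and
    Motakis.

    Why it is asymptotically symmetric.  Let [u_0, u_1, ...] be vectors with
    successive supports.  A functional [h] as above that starts in some block
    has fewer averages than the position where the next block starts, and all
    averages after the first one that reaches a block have sizes beyond the start
    of that block, which may be taken as large as one likes.  So [h] sees a
    later block either through its first average, or through boundedly many
    averages of large size.  Let [lam_i] bound the second effect.  The first
    average is a mean of members of the family, and taking means keeps errors
    from piling up.  An induction over the family ([norming_blocks]) gives
    [|u_0 + ... + u_(n-1)| <= max |u_i| + 2 (lam_0 + ... + lam_(n-1))].
    Conversely [|u_i|] (projection onto a block) and [lam_0 + ... + lam_(n-1)]
    (concatenation of the averages, [lower_blocks]) are lower bounds.  These
    quantities do not mention the order of the blocks.  For arbitrary bounded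
    sequences one subtracts the coordinatewise limits along a free ultrafilter:
    the limits belong to the space, and the differences are close to blocks
    because the tails of each vector tend to zero in norm ([tail_small]).
    Hence every iterated limit is equivalent, with constant 11, to the
    order-free quantity [size_estimate].

    Why no subspace is asymptotic-[l_p].  Say that a subspace has [l_1]
    averages if far out it contains normalized vectors on which one average of
    large size is at least a constant, and that it has [c_0] vectors if far out
    it contains normalized vectors on which boundedly many averages of large
    sizes are small.  An average of size [t] is at most [1/t + 1/m] on the mean
    of [m] blocks of norm one, so means of [l_1] averages are [c_0] vectors
    ([averages_c0]); without [l_1] averages all vectors far out are [c_0]
    vectors ([no_l1_averages]); and the sum of [n] blocks that are [c_0]
    vectors has norm at most 4, while an average of size [n] is at least 1/4 on it
    ([c0_vectors_l1]).  Therefore every infinite dimensional subspace has both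
    kinds of vectors, with uniform constants.  In the game played in any
    subspace, player (V) can thus choose vectors whose sum has norm at
    least [n / 32], which excludes [p > 1] and [c_0] ([l1_game]), and also vectors
    whose sum has norm at most 4, which excludes [p = 1] ([c0_game]). *)

Set Implicit Arguments.
Unset Strict Implicit.
Unset Printing Implicit Defensive.

Import Order.TTheory GRing.Theory Num.Theory.
Import numFieldNormedType.Exports.

Local Open Scope classical_set_scope.
Local Open Scope ring_scope.

(** * The norming functionals *)

Section Functionals.
Variable R : realType.
Local Notation vec := (nat -> R).
Implicit Types (x y : vec) (f g h : vec -> R) (a b c d k s t : nat).

(** [packed] is the family of sums of successive norming functionals, the
    numerators of averages, and [fast] that of sums of successive averages.  The
    intervals [[a, b)] may be larger than the supports, so that functionals can be
    placed behind one another with gaps; the zero functional is admitted for the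
    same reason.  The size [t] of an average is compared with the interval before
    it and not with its own: otherwise the family would not be stable under
    truncation. *)
Inductive norming : nat -> nat -> (vec -> R) -> Prop :=
| norming0 a b : norming a b (fun=> 0)
| norming_coord a b i (r : R) : (a <= i < b)%N -> `|r| <= 1 ->
    norming a b (fun x => r * x i)
| norming_fast a a' d b h : (a <= a')%N -> (d < a')%N -> fast 2 d a' b h ->
    norming a b h
with packed : nat -> nat -> nat -> (vec -> R) -> Prop :=
| packed0 k a b : packed k a b (fun=> 0)
| packed_cons k a c b f g : (a <= c <= b)%N -> norming a c f ->
    packed k c b g -> packed k.+1 a b (fun x => f x + g x)
with fast : nat -> nat -> nat -> nat -> (vec -> R) -> Prop :=
| fast0 s d a b : fast s d a b (fun=> 0)
| fast_cons s d a c b t g h : (a <= c <= b)%N -> (s <= t)%N ->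
    packed t a c g -> fast c d c b h ->
    fast s d.+1 a b (fun x => t%:R^-1 * g x + h x).

Scheme norming_min := Minimality for norming Sort Prop
with packed_min := Minimality for packed Sort Prop
with fast_min := Minimality for fast Sort Prop.
Combined Scheme norming_packed_fast_ind from norming_min, packed_min, fast_min.

Definition linear_fun f := forall (r : R) x y, f (r *: x + y) = r * f x + f y.

Definition local_on a b f :=
  forall x y, (forall i, (a <= i < b)%N -> x i = y i) -> f x = f y.

Definition chop (A : pred nat) x : vec := fun i => if A i then x i else 0.

Lemma functionals_linear :
  (forall a b f, norming a b f -> linear_fun f) /\
  (forall k a b g, packed k a b g -> linear_fun g) /\
  (forall s d a b h, fast s d a b h -> linear_fun h).
Proof.
apply: norming_packed_fast_ind => //.
- by move=> a b r x y; rewrite mulr0 addr0.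
- move=> a b i r _ _ t x y.
  by rewrite !fctE /= mulrDr; congr (_ + _); rewrite mulrCA.
- by move=> k a b r x y; rewrite mulr0 addr0.
- move=> k a c b f g _ _ fl _ gl r x y.
  by rewrite fl gl; ring.
- by move=> s d a b r x y; rewrite mulr0 addr0.
- move=> s d a c b t g h _ _ _ gl _ hl r x y.
  by rewrite gl hl; ring.
Qed.

Lemma functionals_local :
  (forall a b f, norming a b f -> local_on a b f) /\
  (forall k a b g, packed k a b g -> local_on a b g) /\
  (forall s d a b h, fast s d a b h -> local_on a b h).
Proof.
apply: norming_packed_fast_ind => //.
- by move=> a b i r ai _ x y ->.
- move=> a a' d b h aa _ _ hl x y xy; apply: hl => i /andP[ai ib].
  by apply: xy; rewrite ib (leq_trans aa).
- move=> k a c b f g /andP[ac cb] _ fl _ gl x y xy; congr (_ + _).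
    by apply: fl => i /andP[ai ic]; apply: xy; rewrite ai (leq_trans ic).
  by apply: gl => i /andP[ci ib]; apply: xy; rewrite ib (leq_trans ac).
- move=> s d a c b t g h /andP[ac cb] _ _ gl _ hl x y xy.
  congr (_ * _ + _).
    by apply: gl => i /andP[ai ic]; apply: xy; rewrite ai (leq_trans ic).
  by apply: hl => i /andP[ci ib]; apply: xy; rewrite ib (leq_trans ac).
Qed.

Lemma functionals_widen :
  (forall a b f, norming a b f -> forall a' b', (a' <= a)%N -> (b <= b')%N ->
     norming a' b' f) /\
  (forall k a b g, packed k a b g -> forall k' a' b', (k <= k')%N ->
     (a' <= a)%N -> (b <= b')%N -> packed k' a' b' g) /\
  (forall s d a b h, fast s d a b h -> forall s' d' a' b', (s' <= s)%N ->
     (d <= d')%N -> (a' <= a)%N -> (b <= b')%N -> fast s' d' a' b' h).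
Proof.
apply: norming_packed_fast_ind; try by constructor.
- by move=> a b i r abi r1 a' b' aa bb; apply: norming_coord => //; lia.
- move=> a a' d b h aa da _ IH a0 b0 a0a bb.
  by apply: (@norming_fast _ a' d); [lia| |exact: IH].
- move=> k a c b f g acb _ IHf _ IHg [//|k'] a' b' kk aa bb.
  apply: (@packed_cons _ _ c); first lia.
    exact: IHf.
  exact: IHg.
- move=> s d a c b t g h acb st _ IHg _ IHh s' [//|d'] a' b' ss dd aa bb.
  apply: (@fast_cons _ _ _ c); [lia|lia| |].
    exact: IHg.
  exact: IHh.
Qed.

Lemma functionals_chop (A : pred nat) :
  (forall a b f, norming a b f -> norming a b (fun x => f (chop A x))) /\
  (forall k a b g, packed k a b g -> packed k a b (fun x => g (chop A x))) /\
  (forall s d a b h, fast s d a b h -> fast s d a b (fun x => h (chop A x))).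
Proof.
apply: norming_packed_fast_ind; try by constructor.
- move=> a b i r abi r1; rewrite /chop; case: (A i).
    exact: norming_coord.
  have -> : (fun _ : vec => r * 0) = (fun=> 0) by apply/funext => x; rewrite mulr0.
  exact: norming0.
- by move=> a a' d b h aa da _ IH; apply: norming_fast IH.
- by move=> k a c b f g acb _ IHf _ IHg; apply: (packed_cons acb IHf).
- move=> s d a c b t g h acb st _ IHg _ IHh.
  exact: (fast_cons acb st IHg).
Qed.

Lemma functionals_scale (r : R) : `|r| <= 1 ->
  (forall a b f, norming a b f -> norming a b (fun x => r * f x)) /\
  (forall k a b g, packed k a b g -> packed k a b (fun x => r * g x)) /\
  (forall s d a b h, fast s d a b h -> fast s d a b (fun x => r * h x)).
Proof.
move=> r1.
have r0 : (fun _ : vec => r * 0) = (fun=> 0) by apply/funext => x; rewrite mulr0.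
apply: norming_packed_fast_ind; rewrite ?r0; try by constructor.
- move=> a b i q abi q1.
  have -> : (fun x : vec => r * (q * x i)) = (fun x => (r * q) * x i).
    by apply/funext => x; rewrite mulrA.
  apply: norming_coord => //; rewrite normrM.
  by rewrite mulr_ile1.
- by move=> a a' d b h aa da _ IH; apply: norming_fast IH.
- move=> k a c b f g acb _ IHf _ IHg.
  rewrite (_ : (fun x => _) = (fun x => r * f x + r * g x)).
    exact: (packed_cons acb IHf).
  by apply/funext => x; rewrite mulrDr.
- move=> s d a c b t g h acb st _ IHg _ IHh.
  rewrite (_ : (fun x => _) = (fun x => t%:R^-1 * (r * g x) + r * h x)).
    exact: (fast_cons acb st IHg).
  by apply/funext => x; rewrite mulrDr mulrCA.
Qed.

Lemma local0 a b f x : local_on a b f -> linear_fun f ->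
  (forall i, (a <= i < b)%N -> x i = 0) -> f x = 0.
Proof.
move=> fl fL x0; have := fL 1 0 0; rewrite scaler0 add0r mul1r => /eqP.
rewrite addrC -subr_eq subrr eq_sym => /eqP f0.
by rewrite -f0; apply: fl => i /x0.
Qed.

(** A truncation on the left deletes the averages that end before [q].  The
    one that is cut becomes the first, of which only size at least 2 is required,
    and those after it still exceed the end of their predecessor; the condition
    of Schreier only improves, because the beginning moves to the right. *)
Lemma functionals_cut_left q :
  (forall a b f, norming a b f -> (q <= b)%N ->
     norming (maxn a q) b (fun x => f (chop (leq q) x))) /\
  (forall k a b g, packed k a b g -> (q <= b)%N ->
     packed k (maxn a q) b (fun x => g (chop (leq q) x))) /\
  (forall s d a b h, fast s d a b h -> (q <= b)%N -> (2 <= s)%N -> (d < a)%N ->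
     norming (maxn a q) b (fun x => h (chop (leq q) x))).
Proof.
have vanish a c f (x : vec) : local_on a c f -> linear_fun f -> (c <= q)%N ->
    f (chop (leq q) x) = 0.
  move=> fl fL cq; apply: (local0 fl fL) => i /andP[ai ic].
  by rewrite /chop ifF //; apply/negbTE; rewrite -ltnNge (leq_trans ic).
have [Wl [Al Fl]] := functionals_linear; have [Wc [Ac Fc]] := functionals_local.
apply: norming_packed_fast_ind; try by constructor.
- move=> a b i r abi r1 qb; rewrite /chop; case: leqP => qi.
    by apply: norming_coord => //; lia.
  have -> : (fun _ : vec => r * 0) = (fun=> 0) by apply/funext => x; rewrite mulr0.
  exact: norming0.
- move=> a a' d b h aa da _ IH qb.
  have [Ww _] := functionals_widen.
  by apply: (Ww _ _ _ (IH qb (leqnn 2) da)); lia.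
- move=> k a c b f g acb Wf IHf Ag IHg qb.
  have [cq|/ltnW qc] := leqP c q.
    rewrite (_ : (fun x => _) = (fun x => g (chop (leq q) x))); last first.
      by apply/funext => x; rewrite (vanish _ _ _ _ (Wc _ _ _ Wf) (Wl _ _ _ Wf) cq) add0r.
    have [_ [Aw _]] := functionals_widen.
    by apply: (Aw _ _ _ _ (IHg qb)); lia.
  apply: (@packed_cons _ _ c); [lia|exact: IHf|].
  by have := IHg qb; rewrite (maxn_idPl qc).
- move=> s d a c b t g h acb st Ag IHg Fh IHh qb s2 da.
  have [cq|/ltnW qc] := leqP c q.
    rewrite (_ : (fun x => _) = (fun x => h (chop (leq q) x))); last first.
      apply/funext => x; rewrite (vanish _ _ _ _ (Ac _ _ _ _ Ag) (Al _ _ _ _ Ag) cq).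
      by rewrite mulr0 add0r.
    have [Ww _] := functionals_widen.
    by apply: (Ww _ _ _ (IHh qb _ _)); lia.
  apply: (@norming_fast _ (maxn a q) d.+1) => //; first lia.
  apply: (@fast_cons _ _ _ c); [lia|lia|exact: IHg|].
  have [_ [_ Fcu]] := functionals_chop (leq q).
  exact: Fcu.
Qed.

Lemma functionals_cut_right q :
  (forall a b f, norming a b f -> (a <= q)%N ->
     norming a (minn b q) (fun x => f (chop (gtn q) x))) /\
  (forall k a b g, packed k a b g -> (a <= q)%N ->
     packed k a (minn b q) (fun x => g (chop (gtn q) x))) /\
  (forall s d a b h, fast s d a b h -> (a <= q)%N ->
     fast s d a (minn b q) (fun x => h (chop (gtn q) x))).
Proof.
have vanish c b f (x : vec) : local_on c b f -> linear_fun f -> (q <= c)%N ->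
    f (chop (gtn q) x) = 0.
  move=> fl fL cq; apply: (local0 fl fL) => i /andP[ai ic].
  by rewrite /chop /= ifF //; apply/negbTE; rewrite -leqNgt (leq_trans cq).
have [Wl [Al Fl]] := functionals_linear; have [Wc [Ac Fc]] := functionals_local.
apply: norming_packed_fast_ind; try by constructor.
- move=> a b i r abi r1 qb; rewrite /chop /=; case: ltnP => qi.
    by apply: norming_coord => //; lia.
  have -> : (fun _ : vec => r * 0) = (fun=> 0) by apply/funext => x; rewrite mulr0.
  exact: norming0.
- move=> a a' d b h aa da Fh IH aq; have [qa|qa] := leqP a' q.
    by apply: norming_fast (IH qa).
  rewrite (_ : (fun x => _) = fun=> 0); first exact: norming0.
  by apply/funext => x; rewrite (vanish _ _ _ _ (Fc _ _ _ _ _ Fh) (Fl _ _ _ _ _ Fh)) // ltnW.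
- move=> k a c b f g acb Wf IHf Ag IHg aq.
  have [cq|/ltnW qc] := leqP c q.
    by apply: (@packed_cons _ _ c); [lia| |exact: IHg]; have := IHf aq;
       rewrite (minn_idPl cq).
  rewrite (_ : (fun x => _) = (fun x => f (chop (gtn q) x) + 0)); last first.
    by apply/funext => x; rewrite (vanish _ _ _ _ (Ac _ _ _ _ Ag) (Al _ _ _ _ Ag)).
  have := IHf aq; rewrite (minn_idPr qc) => Wf'.
  by apply: (@packed_cons _ _ q _ _ (fun=> 0)); [lia|by []|exact: packed0].
- move=> s d a c b t g h acb st Ag IHg Fh IHh aq.
  have [cq|/ltnW qc] := leqP c q.
    apply: (@fast_cons _ _ _ c); [lia|by []| |exact: IHh]; have := IHg aq.
    by rewrite (minn_idPl cq).
  rewrite (_ : (fun x => _) = (fun x => t%:R^-1 * g (chop (gtn q) x) + 0)); last first.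
    by apply/funext => x; rewrite (vanish _ _ _ _ (Fc _ _ _ _ _ Fh) (Fl _ _ _ _ _ Fh)).
  have := IHg aq; rewrite (minn_idPr qc) => Ag'.
  by apply: (@fast_cons _ _ _ q _ _ _ (fun=> 0)); [lia|by []|by []|exact: fast0].
Qed.

End Functionals.

(** * Consequences for single functionals *)

Section SingleFunctionals.
Variable R : realType.
Local Notation vec := (nat -> R).
Implicit Types (x y : vec) (f g h : vec -> R) (a b c d k s t : nat).

Lemma norming_linear a b f : norming a b f -> linear_fun f.
Proof. by case: (functionals_linear R) => + _; apply. Qed.

Lemma packed_linear k a b g : packed k a b g -> linear_fun g.
Proof. by case: (functionals_linear R) => _ [+ _]; apply. Qed.

Lemma fast_linear s d a b h : fast s d a b h -> linear_fun h.
Proof. by case: (functionals_linear R) => _ [_]; apply. Qed.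

Lemma norming_local a b f : norming a b f -> local_on a b f.
Proof. by case: (functionals_local R) => + _; apply. Qed.

Lemma packed_local k a b g : packed k a b g -> local_on a b g.
Proof. by case: (functionals_local R) => _ [+ _]; apply. Qed.

Lemma fast_local s d a b h : fast s d a b h -> local_on a b h.
Proof. by case: (functionals_local R) => _ [_]; apply. Qed.

Lemma norming_widen a b a' b' f : norming a b f -> (a' <= a)%N ->
  (b <= b')%N -> norming a' b' f.
Proof. by case: (functionals_widen R) => wW _ fn; apply: wW. Qed.

Lemma packed_widen k a b k' a' b' g : packed k a b g -> (k <= k')%N ->
  (a' <= a)%N -> (b <= b')%N -> packed k' a' b' g.
Proof. by case: (functionals_widen R) => _ [wA _] gn; apply: wA. Qed.

Lemma fast_widen s d a b s' d' a' b' h : fast s d a b h -> (s' <= s)%N ->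
  (d <= d')%N -> (a' <= a)%N -> (b <= b')%N -> fast s' d' a' b' h.
Proof. by case: (functionals_widen R) => _ [_ wF] gn; apply: wF. Qed.

Lemma norming_chop (A : pred nat) a b f : norming a b f ->
  norming a b (fun x => f (chop A x)).
Proof. by case: (@functionals_chop R A) => + _; apply. Qed.

Lemma fast_chop (A : pred nat) s d a b h : fast s d a b h ->
  fast s d a b (fun x => h (chop A x)).
Proof. by case: (@functionals_chop R A) => _ [_ +]; apply. Qed.

Lemma norming_scale (r : R) a b f : `|r| <= 1 -> norming a b f ->
  norming a b (fun x => r * f x).
Proof. by move=> /functionals_scale[+ _]; apply. Qed.

Lemma fast_scale (r : R) s d a b h : `|r| <= 1 -> fast s d a b h ->
  fast s d a b (fun x => r * h x).
Proof. by move=> /functionals_scale[_ [_ +]]; apply. Qed.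

Lemma fast_norming s d a b h : (2 <= s)%N -> (d < a)%N -> fast s d a b h ->
  norming a b h.
Proof.
move=> s2 da hF; apply: (@norming_fast _ a a d) => //.
exact: (fast_widen hF).
Qed.

(** What a vector does on [[p, q)] is witnessed by functionals that live on
    [[p, q)], and those can be lined up block by block. *)
Lemma norming_restrict p q a b f : (p <= q)%N -> norming a b f ->
  norming p q (fun x => f (chop (fun i => p <= i < q)%N x)).
Proof.
move=> pq fn.
have fn1 : norming 0 (b + q) f by apply: norming_widen fn _ _ => //; lia.
have [cl _] := functionals_cut_left R p; have [cr _] := functionals_cut_right R q.
have pb : (p <= b + q)%N by lia.
have := cl _ _ _ fn1 pb; rewrite max0n => /cr /(_ pq).
rewrite (_ : minn (b + q) q = q); last lia.
congr norming; apply/funext => x; congr f; apply/funext => i.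
by rewrite /chop /=; case: (p <= i)%N.
Qed.

Lemma fast_cat s d d' a c b h h' : fast s d a c h -> (a <= c)%N -> (s <= c)%N ->
  (c <= b)%N -> fast c d' c b h' -> fast s (d + d') a b (fun x => h x + h' x).
Proof.
move=> H; elim: H b d' h' => {s d a c h}.
- move=> s d a c b d' h' ac sc cb H.
  rewrite (_ : (fun x => _) = h'); last by apply/funext => x; rewrite add0r.
  by apply: fast_widen H _ _ _ _; lia.
- move=> s d a e c t g h aec st Ag Fh IH b d' h' ac sc cb H.
  rewrite (_ : (fun x => _) = (fun x => t%:R^-1 * g x + (h x + h' x))); last first.
    by apply/funext => x; rewrite addrA.
  rewrite addSn; apply: (@fast_cons _ _ _ _ e) => //; first lia.
  by apply: IH => //; lia.
Qed.

Lemma lin0 f : linear_fun f -> f 0 = 0.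
Proof.
by move=> fl; have := fl (-1) 0 0; rewrite scaler0 addr0 mulN1r addNr.
Qed.

Lemma linD f x y : linear_fun f -> f (x + y) = f x + f y.
Proof. by move=> fl; have := fl 1 x y; rewrite scale1r mul1r. Qed.

Lemma linZ f (r : R) x : linear_fun f -> f (r *: x) = r * f x.
Proof. by move=> fl; have := fl r x 0; rewrite (lin0 fl) !addr0. Qed.

Lemma linN f x : linear_fun f -> f (- x) = - f x.
Proof. by move=> fl; rewrite -scaleN1r linZ // mulN1r. Qed.

Lemma linB f x y : linear_fun f -> f (x - y) = f x - f y.
Proof. by move=> fl; rewrite linD // linN. Qed.

Lemma lin_sum f I (r : seq I) (P : pred I) (v : I -> vec) : linear_fun f ->
  f (\sum_(i <- r | P i) v i) = \sum_(i <- r | P i) f (v i).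
Proof.
move=> fl; elim/big_rec2: _ => [|i y x _ <-]; first exact: lin0.
by rewrite linD.
Qed.

(** Adding functionals of disjoint supports and dividing by the size preserve the
    bound; it puts the finitely supported sequences in the space. *)
Lemma functionals_l1_bound :
  (forall a b f, norming a b f -> forall x,
    `|f x| <= \sum_(a <= i < b) `|x i|) /\
  (forall k a b g, packed k a b g -> forall x,
    `|g x| <= \sum_(a <= i < b) `|x i|) /\
  (forall s d a b h, fast s d a b h -> forall x,
    `|h x| <= \sum_(a <= i < b) `|x i|).
Proof.
have z a b x : `|0 : R| <= \sum_(a <= i < b) `|x i|.
  by rewrite normr0 sumr_ge0.
apply: norming_packed_fast_ind => //.
- move=> a b i r abi r1 x; rewrite normrM.
  rewrite (big_cat_nat (n := i)) //=; [|lia|lia].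
  rewrite (@big_ltn _ _ _ i); last lia.
  rewrite addrCA; apply: (@le_trans _ _ `|x i|); first by rewrite ler_piMl.
  by rewrite lerDl addr_ge0 // sumr_ge0.
- move=> a a' d b h aa _ _ IH x; apply: (le_trans (IH x)).
  have [ab|/ltnW ba] := leqP a' b; last by rewrite big_geq // sumr_ge0.
  by rewrite [leRHS](big_cat_nat (n := a')) //= lerDr sumr_ge0.
- move=> k a c b f g /andP[ac cb] _ IHf _ IHg x.
  rewrite (big_cat_nat (n := c)) //=.
  by apply: (le_trans (ler_normD _ _)); exact: lerD.
- move=> s d a c b t g h /andP[ac cb] _ _ IHg _ IHh x.
  rewrite (big_cat_nat (n := c)) //=.
  apply: (le_trans (ler_normD _ _)); apply: lerD => //.
  rewrite normrM normfV normr_nat; apply: le_trans (IHg x).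
  by case: t => [|t]; rewrite ?invr0 ?mul0r // ler_piMl // invf_le1 // ler1n.
Qed.

(** A member of the family reads finitely many coordinates.  Completeness of
    the space and the lower semicontinuity of its norm for coordinatewise limits
    rest on this. *)
Lemma functionals_cvg (T : Type) (F : set_system T) (FF : Filter F)
    (x : T -> vec) (z : vec) : (forall i, x t i @[t --> F] --> z i) ->
  (forall a b f, norming a b f -> f (x t) @[t --> F] --> f z) /\
  (forall k a b g, packed k a b g -> g (x t) @[t --> F] --> g z) /\
  (forall s d a b h, fast s d a b h -> h (x t) @[t --> F] --> h z).
Proof.
move=> xz; apply: norming_packed_fast_ind => //.
- by move=> a b; apply: cvg_cst.
- by move=> a b i r _ _; apply: cvgMr.
- by move=> k a b; apply: cvg_cst.
- by move=> k a c b f g _ _ IHf _ IHg; apply: cvgD.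
- by move=> s d a b; apply: cvg_cst.
- by move=> s d a c b t g h _ _ _ IHg _ IHh; apply: cvgD => //; apply: cvgMr.
Qed.

End SingleFunctionals.


(** * The Banach space *)

Section Space.
Variable R : realType.
Local Notation vec := (nat -> R).

Definition norming_bounded (x : vec) :=
  exists B, forall a b f, norming a b f -> `|f x| <= B.

Definition norming_boundedb : pred vec := fun x => `[< norming_bounded x >].

Record avg_space := AvgSpace { coords :> vec; _ : norming_boundedb coords }.

HB.instance Definition _ := [isSub for coords].
HB.instance Definition _ := [Choice of avg_space by <:].

Lemma norming_bounded_submod :
  submod_closed norming_boundedb.
Proof.
split=> [|r x y /asboolP[B xB] /asboolP[C yC]]; apply/asboolP.
  by exists 0 => a b f /norming_linear /lin0 ->; rewrite normr0.
exists (`|r| * B + C) => a b f fn.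
rewrite (norming_linear fn); apply: (le_trans (ler_normD _ _)).
by rewrite normrM; apply: lerD; [apply: ler_wpM2l => //; exact: xB fn|exact: yC fn].
Qed.

HB.instance Definition _ := GRing.isSubmodClosed.Build R vec
  norming_boundedb norming_bounded_submod.
HB.instance Definition _ := [SubChoice_isSubLmodule of avg_space by <:].

Definition space_norm (x : avg_space) : R :=
  sup [set r | exists a b f, norming a b f /\ r = `|f (val x)|].

Lemma spaceP (x : avg_space) : norming_bounded (val x).
Proof. by case: x => x /= /asboolP. Qed.

Lemma space_norm_ge (x : avg_space) a b f : norming a b f ->
  `|f (val x)| <= space_norm x.
Proof.
move=> fn; apply: ub_le_sup; last by exists a, b, f.
have [B xB] := spaceP x.
by exists B => _ [c [e [g [gn ->]]]]; exact: xB gn.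
Qed.

Lemma space_norm_le (x : avg_space) B :
  (forall a b f, norming a b f -> `|f (val x)| <= B) -> space_norm x <= B.
Proof.
move=> xB; apply: ge_sup; last by move=> _ [c [e [g [gn ->]]]]; exact: xB gn.
by exists `|0 : R|, 0%N, 0%N, (fun=> 0); split => //; constructor.
Qed.

Lemma space_norm_gt (x : avg_space) r : r < space_norm x ->
  exists a b f, norming a b f /\ r < f (val x).
Proof.
move=> rx; suff [a [b [f [fn rf]]]] : exists a b f, norming a b f /\ r < `|f (val x)|.
  have [f0|f0] := leP 0 (f (val x)).
    by exists a, b, f; rewrite ger0_norm // in rf.
  exists a, b, (fun x => -1 * f x); split.
    by apply: norming_scale => //; rewrite normrN1.
  by rewrite mulN1r -(ltr0_norm f0).
apply: contrapT => H; move: rx; rewrite ltNge => /negP; apply.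
apply: space_norm_le => a b f fn; rewrite leNgt; apply/negP => rf.
by apply: H; exists a, b, f.
Qed.

Lemma space_normD x y : space_norm (x + y) <= space_norm x + space_norm y.
Proof.
apply: space_norm_le => a b f fn; rewrite raddfD /= linD; last exact: norming_linear fn.
apply: (le_trans (ler_normD _ _)).
by apply: lerD; exact: (space_norm_ge _ fn).
Qed.

Lemma space_normZ (r : R) x : space_norm (r *: x) = `|r| * space_norm x.
Proof.
have le1 (s : R) y : space_norm (s *: y) <= `|s| * space_norm y.
  apply: space_norm_le => a b f fn.
  rewrite linearZ /= linZ; last exact: norming_linear fn.
  by rewrite normrM ler_wpM2l // (space_norm_ge _ fn).
apply/eqP; rewrite eq_le le1 /=.
have [->|r0] := eqVneq r 0.
  rewrite normr0 mul0r.
  by apply: le_trans (space_norm_ge _ (norming0 _ 0 0)).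
have := le1 r^-1 (r *: x); rewrite scalerA mulVf // scale1r normfV.
by rewrite mulrC ler_pdivlMr ?normr_gt0 // mulrC.
Qed.

Lemma space_norm_coord (x : avg_space) i : `|val x i| <= space_norm x.
Proof.
rewrite -[val x i]mul1r.
by apply: (@space_norm_ge x i i.+1 (fun x => 1 * x i)); apply: norming_coord; rewrite ?normr1 //; lia.
Qed.

Lemma space_norm0_eq0 x : space_norm x = 0 -> x = 0.
Proof.
move=> x0; apply: val_inj; apply/funext => i.
by have := space_norm_coord x i; rewrite x0 normr_le0 => /eqP.
Qed.

HB.instance Definition _ := Lmodule_isNormed.Build R avg_space
  space_normD space_normZ space_norm0_eq0.

Lemma space_complete (F : set_system avg_space) :
  ProperFilter F -> cauchy F -> cvg F.
Proof.
move=> FF /cauchyP Fc; apply/cvg_ex.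
have cvi i : exists l : R, val x i @[x --> F] --> l.
  apply/cvg_ex; apply: cauchy_cvg; apply/cauchy_exP => e e0.
  have [x Fx] := Fc _ e0; exists (val x i).
  suff : F [set y : avg_space | ball (val x i) e (val y i)] by [].
  apply: filterS Fx => y; rewrite -!ball_normE /= => xy.
  apply: le_lt_trans xy.
  by have := space_norm_coord (x - y) i.
pose z i := projT1 (cid (cvi i)).
have zP i : val x i @[x --> F] --> z i by rewrite /z; case: cid.
have [cvF _] := functionals_cvg FF zP.
have est x e : F (ball x e) -> forall a b f, norming a b f -> `|f (val x) - f z| <= e.
  move=> Fx a b f fn.
  apply: (@closed_cvg _ _ F _ (fun y : avg_space => f (val x) - f (val y))
    [set r | `|r| <= e]).
  - rewrite (_ : [set r | _] = Num.norm @^-1` [set r : R | r <= e]) //.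
    apply: closed_comp => [r _|]; last exact: closed_le.
    exact: norm_continuous.
  - apply: filterS Fx => y; rewrite -ball_normE /= => /ltW xy.
    apply: le_trans xy; rewrite -linB; last exact: norming_linear fn.
    by have := space_norm_ge (x - y : avg_space) fn; rewrite raddfB.
  - by apply: cvgB; [exact: cvg_cst|exact: cvF fn].
have zb : norming_bounded z.
  have [x Fx] := Fc _ (@ltr01 R); exists (`|x| + 1) => a b f fn.
  have := est _ _ Fx _ _ _ fn; have := space_norm_ge x fn.
  rewrite -[space_norm x]/(`|x|).
  rewrite !ler_norml; lra.
pose Z := AvgSpace (asboolT zb); exists Z.
apply/cvgrPdist_le => e e0.
have e20 : 0 < e / 2 by rewrite divr_gt0.
have [x Fx] := Fc _ e20.
apply: filterS (Fx) => y xy.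
have xy2 : `|x - y| <= e / 2 by move: xy; rewrite -ball_normE /= => /ltW.
have xz : `|x - Z| <= e / 2.
  apply: space_norm_le => a b f fn; rewrite raddfB /= linB; last exact: norming_linear fn.
  exact: est Fx _ _ _ fn.
rewrite (_ : Z - y = (Z - x) + (x - y)); last by rewrite addrA subrK.
rewrite (splitr e); apply: (le_trans (ler_normD _ _)); apply: lerD => //.
by rewrite distrC.
Qed.

HB.instance Definition _ := Uniform_isComplete.Build avg_space space_complete.

End Space.

(** * Tails, and the action of functionals on blocks *)

Section Bounds.
Variable R : realType.
Local Notation vec := (nat -> R).
Implicit Types (x y : vec) (f g h : vec -> R) (a b c d k s t : nat).

Definition bounded_by x (B : R) :=
  forall a b f, norming a b f -> `|f x| <= B.

Lemma bounded_by_norm (x : avg_space R) B : `|x| <= B <-> bounded_by (val x) B.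
Proof.
split=> [xB a b f fn|]; last exact: space_norm_le.
exact: le_trans (space_norm_ge x fn) xB.
Qed.

Lemma bounded_by_chop (A : pred nat) x B :
  bounded_by x B -> bounded_by (chop A x) B.
Proof. by move=> xB a b f /(norming_chop A)/xB. Qed.

Lemma bounded_byD x y B C :
  bounded_by x B -> bounded_by y C -> bounded_by (x + y) (B + C).
Proof.
move=> xB yC a b f fn; rewrite (linD _ _ (norming_linear fn)).
apply: (le_trans (ler_normD _ _)); apply: lerD; [exact: xB fn|exact: yC fn].
Qed.

Lemma bounded_byN x B : bounded_by x B -> bounded_by (- x) B.
Proof.
by move=> xB a b f fn; rewrite (linN _ (norming_linear fn)) normrN; exact: xB fn.
Qed.

Lemma bounded_by_sum n (v : 'I_n -> vec) (B : 'I_n -> R) :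
  (forall i, bounded_by (v i) (B i)) ->
  bounded_by (\sum_(i < n) v i) (\sum_(i < n) B i).
Proof.
move=> vB a b f fn; rewrite lin_sum; last exact: norming_linear fn.
apply: (le_trans (ler_norm_sum _ _ _)); apply: ler_sum => i _.
exact: vB fn.
Qed.

(** If the tails of [x] stayed above [e], there would be functionals worth
    more than [e] on [x] arbitrarily far out.  Averages of these are also worth
    [e], at any size, so that a fast sum of [d] of them is worth [d * e], which is
    unbounded.  Thus the space does not contain [c_0], and finitely supported
    vectors are dense. *)
Lemma tail_small (x : avg_space R) (e : R) : 0 < e ->
  exists q, forall q', (q <= q')%N -> bounded_by (chop (leq q') (val x)) e.
Proof.
move=> e0; suff [q qe] : exists q, bounded_by (chop (leq q) (val x)) e.
  exists q => q' qq; rewrite (_ : chop _ _ = chop (leq q') (chop (leq q) (val x))).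
    exact: bounded_by_chop.
  apply/funext => i; rewrite /chop; case: leqP => // q'i.
  by rewrite (leq_trans qq q'i).
apply: contrapT => /forallNP H.
have one q : exists b f, [/\ (q <= b)%N, norming q b f & e <= f (val x)].
  have [a [b [f [fn fe]]]] : exists a b f, norming a b f /\
      e < `|f (chop (leq q) (val x))|.
    apply: contrapT => N; apply: (H q) => a b f fn; rewrite leNgt.
    by apply/negP => fe; apply: N; exists a, b, f.
  have qb : (q <= maxn b q)%N by rewrite leq_maxr.
  have fn' := norming_restrict qb fn.
  have E : f (chop (fun i => q <= i < maxn b q)%N (val x)) =
           f (chop (leq q) (val x)).
    apply: (norming_local fn) => i /andP[_ ib]; rewrite /chop.
    by rewrite (leq_trans ib (leq_maxl _ _)) andbT.
  have [f0|f0] := leP 0 (f (chop (leq q) (val x))).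
    exists (maxn b q); eexists; split; [by []|exact: fn'|].
    by rewrite /= E ltW // -(ger0_norm f0).
  exists (maxn b q), (fun y => -1 * f (chop (fun i => q <= i < maxn b q)%N y)).
  split => //; first by apply: norming_scale => //; rewrite normrN1.
  by rewrite mulN1r E ltW // -(ltr0_norm f0).
have many k : forall q, exists b g,
    [/\ (q <= b)%N, packed k q b g & k%:R * e <= g (val x)].
  elim: k => [|k IH] q.
    by exists q, (fun=> 0); split=> //; [constructor|rewrite mul0r].
  have [c [f [qc fn fe]]] := one q; have [b [g [cb gn ge]]] := IH c.
  exists b, (fun y => f y + g y); split; first lia.
    by apply: (@packed_cons _ _ _ c); [lia| |].
  by rewrite -natr1 mulrDl mul1r addrC lerD.
have quick d : forall q, (2 <= q)%N -> exists b h,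
    [/\ (q <= b)%N, fast q d q b h & d%:R * e <= h (val x)].
  elim: d => [|d IH] q q2.
    by exists q, (fun=> 0); split=> //; [constructor|rewrite mul0r].
  have [c [g [qc gn ge]]] := many q q.
  have [b [h [cb hn he]]] := IH c (leq_trans q2 qc).
  exists b, (fun y => q%:R^-1 * g y + h y); split; first lia.
    by apply: (@fast_cons _ _ _ _ c); [lia|by []| |].
  rewrite -natr1 mulrDl mul1r addrC lerD //.
  by rewrite ler_pdivlMl // ltr0n (leq_trans _ q2).
have [B xB] := spaceP x.
have [d dB] : exists d : nat, B / e < d%:R.
  exists (Num.bound `|B / e|); apply: (le_lt_trans (ler_norm _)).
  exact: archi_boundP.
have [b [h [_ hn he]]] := quick d d.+2 isT.
have /xB hB : norming d.+2 b h by apply: fast_norming hn.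
have : B < h (val x).
  by apply: lt_le_trans he; rewrite -ltr_pdivrMr.
by rewrite ltNge (le_trans (ler_norm _) hB).
Qed.

End Bounds.

Section Blocks.
Variable R : realType.
Local Notation vec := (nat -> R).
Variables (n : nat) (q : nat -> nat) (v : nat -> vec) (M : R).
Hypothesis q_mono : forall i j, (i <= j <= n)%N -> (q i <= q j)%N.
Hypothesis v_supp : forall i k, (i < n)%N -> ~~ (q i <= k < q i.+1)%N -> v i k = 0.
Hypothesis M_ge0 : 0 <= M.
Hypothesis v_bound : forall i, (i < n)%N -> bounded_by (v i) M.
Implicit Types (f g h : vec -> R) (a b c d k s t : nat).

Let lam_sum (lam : nat -> R) a b := \sum_(i < n | (a < q i < b)%N) lam i.

Lemma disjoint_block i a b f : (i < n)%N -> local_on a b f -> linear_fun f ->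
  (q i.+1 <= a)%N || (b <= q i)%N -> f (v i) = 0.
Proof.
move=> ni fl fL ab; apply: (local0 fl fL) => k kab; apply: v_supp => //; lia.
Qed.

Lemma lam_sum_add lam a b c : (forall i, 0 <= lam i) -> (a <= c <= b)%N ->
  lam_sum lam a c + lam_sum lam c b <= lam_sum lam a b.
Proof.
move=> lam0 acb; rewrite /lam_sum.
rewrite [X in X + _]big_mkcond [X in _ + X]big_mkcond [leRHS]big_mkcond -big_split /=.
apply: ler_sum => i _; have := lam0 i.
case: ifPn => h1; case: ifPn => h2; case: ifPn => h3 li; rewrite ?addr0 ?add0r //; lia.
Qed.

Lemma lam_sum_ge0 lam a b : (forall i, 0 <= lam i) -> 0 <= lam_sum lam a b.
Proof. by move=> lam0; apply: sumr_ge0. Qed.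

Lemma norm_sum_blocks_le f lam a b : linear_fun f ->
  (forall i, (i < n)%N -> `|f (v i)| <= if (a < q i < b)%N then lam i else 0) ->
  `|f (\sum_(i < n) v i)| <= lam_sum lam a b.
Proof.
move=> fL fv; rewrite lin_sum // /lam_sum [leRHS]big_mkcond /=.
apply: (le_trans (ler_norm_sum _ _ _)); apply: ler_sum => i _.
exact: fv.
Qed.

(** [i0] is the block in which the interval of [f] begins. *)
Lemma norm_sum_blocks_le_head f lam a b (i0 : nat) : linear_fun f -> (i0 < n)%N ->
  `|f (v i0)| <= M -> (q i0 <= a)%N ->
  (forall i, (i < n)%N -> i != i0 ->
    `|f (v i)| <= if (a < q i < b)%N then lam i else 0) ->
  `|f (\sum_(i < n) v i)| <= M + lam_sum lam a b.
Proof.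
move=> fL i0n fv0 qa fv; rewrite lin_sum // /lam_sum [X in _ <= _ + X]big_mkcond /=.
rewrite (bigD1 (Ordinal i0n)) //= [in leRHS](bigD1 (Ordinal i0n)) //=.
rewrite ifF ?add0r; last by rewrite ltnNge qa.
apply: (le_trans (ler_normD _ _)); apply: lerD => //.
apply: (le_trans (ler_norm_sum _ _ _)); apply: ler_sum => i ii0.
exact: fv.
Qed.

(** A norming functional costs at most [M] for the block in which its interval
    begins and [M] for each block that begins strictly inside.  The former are
    counted by [k]; the latter are different for successive functionals, so there
    are at most [n] of them altogether. *)
Lemma packed_blocks k a b g : packed k a b g ->
  `|g (\sum_(i < n) v i)| <= (k + n)%:R * M.
Proof.
have lam0 : forall i : nat, 0 <= (fun=> M) i by [].
suff H : (forall a b f, norming a b f ->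
      `|f (\sum_(i < n) v i)| <= M + lam_sum (fun=> M) a b).
  move=> gn; apply: (@le_trans _ _ (k%:R * M + lam_sum (fun=> M) a b)).
    elim: gn => {k a b g} [k a b|k a c b f g acb fn gn IH].
      by rewrite normr0 addr_ge0 ?mulr_ge0 ?lam_sum_ge0.
    apply: (le_trans (ler_normD _ _)); apply: (le_trans (lerD (H _ _ _ fn) IH)).
    have := lam_sum_add lam0 acb; clear lam0; rewrite -natr1; lra.
  rewrite natrD mulrDl lerD2l /lam_sum [leLHS]big_mkcond /=.
  rewrite mulr_natl -[X in _ *+ X]card_ord -sumr_const.
  by apply: ler_sum => i _; case: ifP.
move=> {}a {}b f fn; have fL := norming_linear fn; have fl := norming_local fn.
have [[i0 [i0n /andP[qa aq]]]|no] :=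
  pselect (exists i0, (i0 < n)%N /\ (q i0 <= a < q i0.+1)%N).
  apply: (@norm_sum_blocks_le_head _ _ _ _ i0) => //; first exact: v_bound fn.
  move=> i ni ii0; case: ifP => [_|/negbT aqb]; first exact: v_bound fn.
  rewrite (disjoint_block ni fl fL) ?normr0 //.
  have [ii|ii] := ltnP i i0.
    by apply/orP; left; apply: (leq_trans _ qa); apply: q_mono; lia.
  have : (q i0.+1 <= q i)%N by apply: q_mono; lia.
  lia.
apply: (@le_trans _ _ (lam_sum (fun=> M) a b)); last by rewrite lerDr.
apply: norm_sum_blocks_le => // i ni; case: ifP => [_|/negbT aqb]; first exact: v_bound fn.
rewrite (disjoint_block ni fl fL) ?normr0 //.
rewrite leqNgt; apply/negPn/negP => H; apply: no; exists i; split => //; lia.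
Qed.

(** The sum on the right runs over the blocks that start strictly inside
    [[a, b)]; it is superadditive in the interval, which is what makes the
    induction work for sums of successive functionals.  For a fast sum
    [g / t + h] there are two cases.  If the first average ends in the block where
    it begins, that block costs at most [M] as a whole, and [h] costs [lam i] on
    each later block.  Otherwise [h] costs only these [lam i], and the mean
    [g / t] costs at most [M] plus the sum of the [lam i] once, because [t >= 2]
    absorbs the factor 2 of the induction hypothesis. *)
Lemma norming_blocks (lam : nat -> R) : (forall i, 0 <= lam i) ->
  (forall i a d b h, (i < n)%N -> (q 0 <= a)%N -> (d <= q i)%N ->
     fast a d a b h -> `|h (v i)| <= lam i) ->
  forall a b f, norming a b f ->
    `|f (\sum_(i < n) v i)| <= M + 2 * lam_sum lam a b.
Proof.
move=> lam0 Hlam.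
suff [] : (forall a b f, norming a b f ->
    `|f (\sum_(i < n) v i)| <= M + 2 * lam_sum lam a b) /\
  (forall k a b g, packed k a b g ->
    `|g (\sum_(i < n) v i)| <= k%:R * M + 2 * lam_sum lam a b) /\
  (forall s d a b h, fast s d a b h -> (2 <= s)%N -> (d < a)%N ->
    `|h (\sum_(i < n) v i)| <= M + 2 * lam_sum lam a b) by [].
have mono a' b' a b : (a <= a')%N -> (b' <= b)%N ->
    lam_sum lam a' b' <= lam_sum lam a b.
  move=> aa bb; rewrite /lam_sum big_mkcond [leRHS]big_mkcond /=.
  apply: ler_sum => i _; have := lam0 i.
  case: ifPn => h1; case: ifPn => h2; rewrite //; lia.
apply: norming_packed_fast_ind.
- by move=> a b; rewrite normr0 addr_ge0 // mulr_ge0 // lam_sum_ge0.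
- move=> a b i r abi r1.
  have fn : norming a b (fun x => r * x i) by apply: norming_coord.
  have fL := norming_linear fn; have fl := norming_local fn.
  apply: (@le_trans _ _ M); last by rewrite lerDl mulr_ge0 // lam_sum_ge0.
  have [[i0 [i0n qi]]|no] :=
    pselect (exists i0, (i0 < n)%N /\ (q i0 <= i < q i0.+1)%N).
    rewrite fct_sumE (bigD1 (Ordinal i0n)) //= big1 ?addr0.
      exact: (v_bound i0n fn).
    move=> j ji0; apply: v_supp => //; apply/negP => qj.
    have {ji0} : (j : nat) != i0 by [].
    have [ij _|ij _|//] := ltngtP j i0.
      have : (q j.+1 <= q i0)%N by apply: q_mono; lia.
      lia.
    have : (q i0.+1 <= q j)%N by apply: q_mono; have := ltn_ord j; lia.
    lia.
  rewrite fct_sumE big1 ?mulr0 ?normr0 // => j _.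
  by apply: v_supp => //; apply/negP => qj; apply: no; exists j.
- move=> a a' d b h aa da hF IH; apply: (le_trans (IH isT da)).
  by rewrite lerD2l ler_pM2l // mono.
- by move=> k a b; rewrite normr0 addr_ge0 ?mulr_ge0 // lam_sum_ge0.
- move=> k a c b f g acb _ IHf _ IHg.
  apply: (le_trans (ler_normD _ _)); apply: (le_trans (lerD IHf IHg)).
  have := lam_sum_add lam0 acb; clear lam0; rewrite -natr1; lra.
- by move=> s d a b *; rewrite normr0 addr_ge0 // mulr_ge0 // lam_sum_ge0.
move=> s d a c b t g h acb st gA IHg hF IHh s2 da.
have fn : norming a b (fun x => t%:R^-1 * g x + h x).
  by apply: (@fast_norming _ s d.+1) => //; apply: (@fast_cons _ _ _ _ c).
have t2 : (2 <= t)%N by exact: leq_trans st.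
have t0 : 0 < t%:R :> R by rewrite ltr0n; lia.
have [gL gl] := (packed_linear gA, packed_local gA).
have [hL hl] := (fast_linear hF, fast_local hF).
have fL := norming_linear fn; have fl := norming_local fn.
have {}IHh := IHh (ltac:(lia)) (ltac:(lia)).
(* h has fewer than a averages, and their sizes are at least c >= q 0, so the
   hypothesis on lam applies to every block that starts after a. *)
have hv i : (i < n)%N -> (q 0 <= c)%N -> (a < q i)%N ->
    `|h (v i)| <= if (a < q i < b)%N then lam i else 0.
  move=> ni q0c aqi; rewrite aqi /=; case: ltnP => qb.
    by apply: (Hlam i c d b) => //; lia.
  by rewrite (disjoint_block ni hl hL) ?normr0 // qb orbT.
have [q0c|cq0] := leqP (q 0) c; last first.
  rewrite (_ : g _ = 0) ?mulr0 ?add0r; last first.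
    rewrite lin_sum // big1 // => i _; apply: (disjoint_block _ gl gL) => //.
    apply/orP; right; apply: (leq_trans (ltnW cq0)); apply: q_mono.
    by rewrite /= ltnW.
  by apply: (le_trans IHh); rewrite lerD2l ler_pM2l // mono //; lia.
have [[i0 [i0n [qa cq]]]|no] :=
  pselect (exists i0, (i0 < n)%N /\ (q i0 <= a)%N /\ (c < q i0.+1)%N).
  apply: (@le_trans _ _ (M + lam_sum lam a b)); last first.
    by rewrite lerD2l ler_peMl ?lam_sum_ge0 // ler1n.
  apply: (@norm_sum_blocks_le_head (fun x => t%:R^-1 * g x + h x) lam a b i0) => //.
    exact: v_bound fn.
  move=> i ni ii0; have [ii|ii|ii] := ltngtP i i0; last by rewrite ii eqxx in ii0.
    rewrite (disjoint_block ni fl fL) ?normr0 //; first by case: ifP.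
    by apply/orP; left; apply: (leq_trans _ qa); apply: q_mono; lia.
  have ci : (c < q i)%N by apply: (leq_trans cq); apply: q_mono; lia.
  rewrite (disjoint_block ni gl gL) ?(ltnW ci) ?orbT // mulr0 add0r.
  by apply: hv => //; lia.
have {}IHg : `|t%:R^-1 * g (\sum_(i < n) v i)| <= M + lam_sum lam a c.
  rewrite normrM normfV (ger0_norm (ltW t0)) ler_pdivrMl // mulrDr.
  apply: (le_trans IHg); rewrite lerD2l.
  by apply: ler_wpM2r; [exact: lam_sum_ge0|rewrite ler_nat].
have {}IHh : `|h (\sum_(i < n) v i)| <= lam_sum lam a b.
  apply: norm_sum_blocks_le => // i ni; have [qa|aq] := leqP (q i) a.
    rewrite (disjoint_block ni hl hL) ?normr0 //=.
    apply/orP; left; rewrite leqNgt; apply/negP => cq.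
    by apply: no; exists i.
  by have := hv i ni q0c aq; rewrite aq.
apply: (le_trans (ler_normD _ _)); apply: (le_trans (lerD IHg IHh)).
have := mono a c a b (leqnn _) (ltac:(lia)); lra.
Qed.

End Blocks.

Section Split.
Variable R : realType.
Local Notation vec := (nat -> R).

(** Only the first average that reaches a vector supported in [[p, oo)] can
    have size below [p]; all later ones have size at least [p]. *)
Lemma fast_first_rest (v : vec) p s0 d (e1 e2 : R) :
  (forall k, (k < p)%N -> v k = 0) -> 0 <= e1 -> 0 <= e2 ->
  (forall a b h, (s0 <= a)%N -> fast a 1 a b h -> `|h v| <= e1) ->
  (forall b h, fast p d p b h -> `|h v| <= e2) ->
  forall a d' b h, (d' <= d)%N -> (s0 <= a)%N -> fast a d' a b h ->
    `|h v| <= e1 + e2.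
Proof.
move=> v0 e10 e20 H1 H2 a d' b h dd sa hF.
suff : forall s d' a b h, fast s d' a b h -> (a <= s)%N -> (d' <= d)%N ->
   (s0 <= a)%N -> `|h v| <= e1 + e2 by apply; [exact: hF|..].
move=> {a d' b h dd sa hF} s d' a b h.
elim=> {s d' a b h} [s d' a b _ _ _|s d' a c b t g h acb st gA hF IH as_ dd sa].
  by rewrite normr0 addr_ge0.
have [cp|pc] := leqP c p.
  rewrite (local0 (packed_local gA) (packed_linear gA)) ?mulr0 ?add0r.
    by apply: IH => //; lia.
  by move=> i ic; apply: v0; lia.
apply: (le_trans (ler_normD _ _)); apply: lerD.
  have hF1 : fast a 1 a c (fun x => t%:R^-1 * g x + 0).
    by apply: (@fast_cons _ _ _ _ c _ _ _ (fun=> 0)) => //; [lia|lia|constructor].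
  by have := H1 _ _ _ sa hF1; rewrite addr0.
by apply: (H2 b); apply: (fast_widen hF) => //; lia.
Qed.

End Split.

(** * Norms of sums of blocks *)

Section Chain.

(** Dependent choice in which a step may look at everything chosen before,
    as the moves in a game do. *)
Lemma chain (T : Type) (P : seq T -> nat -> T -> nat -> Prop) :
  (forall s q, exists x q', (q <= q')%N /\ P s q x q') ->
  forall q0, exists (x : nat -> T) (q : nat -> nat), q 0 = q0 /\
    forall i, (q i <= q i.+1)%N /\ P (mkseq x i) (q i) (x i) (q i.+1).
Proof.
move=> step q0.
have /choice[F FP] : forall sq : seq T * nat, exists xq : T * nat,
    (sq.2 <= xq.2)%N /\ P sq.1 sq.2 xq.1 xq.2.
  by move=> [s q]; have [x [q' H]] := step s q; exists (x, q').
pose st i := iter i (fun sq => (rcons sq.1 (F sq).1, (F sq).2)) ([::], q0).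
exists (fun i => (F (st i)).1), (fun i => (st i).2); split=> // i.
suff -> : mkseq (fun i => (F (st i)).1) i = (st i).1 by exact: FP.
elim: i => //= i IH; rewrite -IH /mkseq -addn1 iotaD map_cat /= cats1.
by rewrite add0n.
Qed.

End Chain.

Section BlockEstimates.
Variable R : realType.
Local Notation X := (avg_space R).
Local Notation vec := (nat -> R).

Definition zero_before (q : nat) (x : X) := forall k, (k < q)%N -> val x k = 0.

(** Every infinite dimensional subspace has vectors that vanish exactly before a
    given position, whereas behind a later one they can only be made small. *)
Definition block (q : nat) (x : X) (q' : nat) (e : R) :=
  zero_before q x /\ bounded_by (chop (leq q') (val x)) e.

Lemma block_exists q x (e : R) B : zero_before q x -> 0 < e ->
  exists q', [/\ (q <= q')%N, (B <= q')%N & block q x q' e].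
Proof.
move=> x0 /(tail_small x)[p pe]; exists (maxn p (maxn q B)); split; [lia|lia|].
by split => //; apply: pe; rewrite leq_maxl.
Qed.

Lemma block_approx q x q' e : block q x q' e ->
  bounded_by (val x - chop (fun k => q <= k < q')%N (val x)) e.
Proof.
move=> [x0 xe]; rewrite (_ : _ - _ = chop (leq q') (chop (leq q') (val x))).
  exact: bounded_by_chop.
apply/funext => k; rewrite /chop !fctE.
have [qk|kq] := leqP q k => /=; last by rewrite x0 // subrr !if_same.
by case: leqP => _ /=; rewrite ?subr0 ?subrr.
Qed.

Lemma val_sum (I : Type) (r : seq I) (P : pred I) (x : I -> X) :
  val (\sum_(i <- r | P i) x i) = \sum_(i <- r | P i) val (x i).
Proof. exact: raddf_sum. Qed.

Section Seq.
Variables (n : nat) (q : nat -> nat) (x : nat -> X) (e : R).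
Hypothesis q_mono : forall i, (q i <= q i.+1)%N.
Hypothesis x_block : forall i, (i < n)%N -> block (q i) (x i) (q i.+1) e.

Let v i := chop (fun k => q i <= k < q i.+1)%N (val (x i)).

Let q_homo i j : (i <= j)%N -> (q i <= q j)%N.
Proof. exact: (homo_leq leqnn (fun y x z => @leq_trans y x z) q_mono). Qed.

Let v_supp i k : ~~ (q i <= k < q i.+1)%N -> v i k = 0.
Proof. by rewrite /v /chop => /negbTE ->. Qed.

Lemma block_sum_approx :
  bounded_by (\sum_(i < n) val (x i) - \sum_(i < n) v i) (n%:R * e).
Proof.
rewrite -sumrB; have -> : n%:R * e = \sum_(i < n) e.
  by rewrite sumr_const card_ord mulr_natl.
by apply: bounded_by_sum => i; apply: block_approx; exact: x_block.
Qed.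

Lemma fast_sum (d : nat -> nat) (h : nat -> vec -> R) :
  (forall i, (i < n)%N -> fast (q i) (d i) (q i) (q i.+1) (h i)) ->
  fast (q 0) (\sum_(i < n) d i) (q 0) (q n) (fun y => \sum_(i < n) h i y).
Proof.
elim: n => [|m IH] hF.
  rewrite big_ord0 (_ : (fun y => _) = (fun=> 0)); first exact: fast0.
  by apply/funext => y; rewrite big_ord0.
rewrite big_ord_recr /= (_ : (fun y => _) =
    (fun y => \sum_(i < m) h i y + h m y)); last first.
  by apply/funext => y; rewrite big_ord_recr.
apply: (@fast_cat _ _ _ _ _ (q m)); rewrite ?q_homo ?q_mono //.
  by apply: IH => i im; apply: hF; rewrite ltnW.
exact: hF.
Qed.

Lemma block_component (i : 'I_n) f : local_on (q i) (q i.+1) f ->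
  f (val (x i)) = f (\sum_(j < n) v j).
Proof.
move=> fl; apply: fl => k ki.
rewrite fct_sumE (bigD1 i) //= big1 ?addr0; first by rewrite /v /chop ki.
move=> j ji; apply: v_supp; apply/negP => kj.
have {}ji : (j : nat) != i by [].
have [/q_homo jq|/q_homo jq|//] := ltngtP j i; [lia|lia|lia].
Qed.

(** Fast sums on successive blocks concatenate, since the sizes on a block
    exceed the end of the block before it.  The hypothesis on the total number of
    averages is the condition of Schreier for the concatenation. *)
Lemma lower_blocks (d : nat -> nat) (h : nat -> vec -> R) :
  (1 < q 0)%N -> (\sum_(i < n) d i < q 0)%N ->
  (forall i, (i < n)%N -> fast (q i) (d i) (q i) (q i.+1) (h i)) ->
  \sum_(i < n) h i (val (x i)) - n%:R * e <= `|\sum_(i < n) x i|.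
Proof.
move=> q1 dq hF; have HF := fast_sum hF.
have Hn := fast_norming q1 dq HF; have HL := norming_linear Hn.
apply: le_trans (space_norm_ge _ Hn); apply: le_trans (ler_norm _).
rewrite val_sum.
have -> : \sum_(i < n) val (x i) = (\sum_(i < n) v i) +
  (\sum_(i < n) val (x i) - \sum_(i < n) v i) by rewrite addrC subrK.
rewrite [leRHS](linD _ _ HL); apply: lerD; last first.
  by have := block_sum_approx Hn; rewrite ler_norml => /andP[].
apply: ler_sum => i _.
rewrite (_ : h i (val (x i)) = h i (\sum_(j < n) v j)) //.
exact: (block_component (fast_local (hF i (ltn_ord i)))).
Qed.

Lemma upper_blocks (M : R) (lam : nat -> R) : 0 <= M -> 
  (forall i, (i < n)%N -> `|x i| <= M) -> (forall i, 0 <= lam i) ->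
  (forall i a d b h, (i < n)%N -> (q 0 <= a)%N -> (d <= q i)%N ->
     fast a d a b h -> `|h (val (x i))| <= lam i) ->
  `|\sum_(i < n) x i| <= M + 2 * \sum_(i < n) lam i + n%:R * e.
Proof.
move=> M0 xM lam0 Hlam; apply/bounded_by_norm; rewrite val_sum.
have -> : \sum_(i < n) val (x i) = (\sum_(i < n) v i) +
  (\sum_(i < n) val (x i) - \sum_(i < n) v i) by rewrite addrC subrK.
apply: bounded_byD block_sum_approx => a b f fn.
have := @norming_blocks _ n q v M _ _ M0 _ lam lam0 _ a b f fn.
move=> /(_ _ _ _ _)/le_trans; apply.
- by move=> i j /andP[ij _]; exact: q_homo.
- by move=> i k _; exact: v_supp.
- by move=> i ni; apply: bounded_by_chop; apply/bounded_by_norm; exact: xM.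
- move=> i c d b' h ni qc dq /(fast_chop (fun k => q i <= k < q i.+1)%N).
  exact: Hlam.
rewrite lerD2l ler_pM2l // [leLHS]big_mkcond /=.
by apply: ler_sum => i _; case: ifP.
Qed.

Lemma packed_block_sum k a b g : (1 < a)%N -> (1 < k)%N ->
  (forall i, (i < n)%N -> `|x i| <= 1) -> packed k a b g ->
  `|k%:R^-1 * g (\sum_(i < n) val (x i))| <= 1 + n%:R / k%:R + n%:R * e.
Proof.
move=> a1 k1 xM gP.
have ab : (a <= maxn a b <= maxn a b)%N by rewrite leq_maxl leqnn.
have {}gP : packed k a (maxn a b) g by apply: (packed_widen gP); rewrite ?leq_maxr.
have gn : norming a (maxn a b) (fun y => k%:R^-1 * g y + 0).
  apply: (@fast_norming _ 2 1) => //.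
  by apply: (@fast_cons _ _ _ _ (maxn a b) _ _ _ (fun=> 0)) => //; exact: fast0.
have k0 : 0 < k%:R :> R by rewrite ltr0n ltnW.
have -> : \sum_(i < n) val (x i) = (\sum_(i < n) v i) +
  (\sum_(i < n) val (x i) - \sum_(i < n) v i) by rewrite addrC subrK.
have gL := packed_linear gP.
rewrite linD // mulrDr; apply: (le_trans (ler_normD _ _)); apply: lerD.
  rewrite normrM normfV (ger0_norm (ltW k0)) ler_pdivrMl //.
  apply: (@le_trans _ _ ((k + n)%:R * 1)); last first.
    by rewrite mulr1 natrD mulrDr mulr1 mulrCA mulfV ?mulr1 // gt_eqF.
  apply: (@packed_blocks _ n q v _ _ _ _ _ k a (maxn a b)) => //.
  - by move=> i j /andP[ij _]; exact: q_homo.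
  - by move=> i l _; exact: v_supp.
  - by move=> i ni; apply: bounded_by_chop; apply/bounded_by_norm; exact: xM.
by have := block_sum_approx gn; rewrite addr0.
Qed.

Lemma block_le_sum i : (i < n)%N ->
  `|x i| <= `|\sum_(j < n) x j| + n%:R * e + e.
Proof.
move=> ni; apply/bounded_by_norm; pose A k := (q i <= k < q i.+1)%N.
pose D := \sum_(j < n) val (x j) - \sum_(j < n) v j.
have -> : val (x i) = chop A (val (\sum_(j < n) x j)) - chop A D +
    (val (x i) - v i).
  apply/funext => k; rewrite !(addrfctE, opprfctE) /= /v /chop -/(A k).
  have [Ak|_] := boolP (A k); last by ring.
  have Al : local_on (q i) (q i.+1) (fun y : vec => y k) by move=> y z; apply.
  have Ev : (\sum_(j < n) v j) k = val (x i) k.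
    by have := @block_component (Ordinal ni) _ Al.
  rewrite /D addrfctE opprfctE -val_sum Ev /=; ring.
apply: bounded_byD (block_approx (x_block ni)).
apply: bounded_byD; first by apply: bounded_by_chop; apply/bounded_by_norm.
by apply: bounded_byN; apply: bounded_by_chop; exact: block_sum_approx.
Qed.

Lemma packed_sum (f : nat -> vec -> R) m j : (j + m <= n)%N ->
  (forall i, (i < n)%N -> norming (q i) (q i.+1) (f i)) ->
  packed m (q j) (q (j + m)) (fun y => \sum_(i < m) f (j + i)%N y).
Proof.
elim: m j => [|m IH] j jm fn.
  rewrite (_ : (fun y => _) = (fun=> 0)); first exact: packed0.
  by apply/funext => y; rewrite big_ord0.
rewrite (_ : (fun y => _) =
    (fun y => f j y + \sum_(i < m) f (j.+1 + i)%N y)); last first.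
  apply/funext => y; rewrite big_ord_recl addn0; congr (_ + _).
  by apply: eq_bigr => i _; rewrite /bump /= addSnnS.
rewrite addnS -addSn; apply: (@packed_cons _ _ _ (q j.+1)).
- by rewrite q_mono q_homo // leq_addr.
- by apply: fn; lia.
- by apply: IH => //; lia.
Qed.

(** The mean of functionals that norm the single blocks is an average of size
    [n] that is large on the sum of the blocks. *)
Lemma average_blocks (f : nat -> vec -> R) : (1 < n)%N -> (1 < q 0)%N ->
  (forall i, (i < n)%N -> norming (q i) (q i.+1) (f i)) ->
  exists2 h, fast n 1 (q 0) (q n) h &
    n%:R^-1 * (\sum_(i < n) f i (val (x i))) - n%:R * e <=
      h (val (\sum_(i < n) x i)).
Proof.
move=> n1 q1 fn; have gP := @packed_sum f n 0 (leqnn n) fn.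
pose h y : R := n%:R^-1 * (\sum_(i < n) f i y) + 0.
have hF : fast n 1 (q 0) (q n) h.
  apply: (@fast_cons _ _ _ _ (q n) _ _ _ (fun=> 0)) => //.
    by rewrite q_homo //=.
  exact: fast0.
exists h => //; have hn := fast_norming n1 q1 hF; have hL := norming_linear hn.
rewrite val_sum.
have -> : \sum_(i < n) val (x i) = (\sum_(i < n) v i) +
  (\sum_(i < n) val (x i) - \sum_(i < n) v i) by rewrite addrC subrK.
rewrite linD //; apply: lerD; last first.
  by have := block_sum_approx hn; rewrite ler_norml => /andP[].
rewrite /h addr0 ler_wpM2l ?invr_ge0 //; apply: ler_sum => i _.
rewrite (_ : f i (val (x i)) = f i (\sum_(j < n) v j)) //.
exact: (block_component (norming_local (fn i (ltn_ord i)))).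
Qed.

End Seq.
End BlockEstimates.

(** * Vectors of type l_1 and c_0 in infinite dimensional subspaces *)

Section Dimension.
Variables (R : realType) (X : normedModType R).
Implicit Types Z Y : set X.

Definition linear_subspace Z :=
  Z 0 /\ forall (r : R) x y, Z x -> Z y -> Z (r *: x + y).

Lemma closed_subspace_linear Z : closed_subspace Z -> linear_subspace Z.
Proof.
move=> [[Z0 ZD] _]; split; first by have := Z0; rewrite !inE.
by move=> r x y Zx Zy; have := ZD r x y; rewrite !inE; apply.
Qed.

Lemma linear_subspaceZ Z (r : R) x : linear_subspace Z -> Z x -> Z (r *: x).
Proof. by move=> [Z0 ZD] Zx; rewrite -[_ *: _]addr0; apply: ZD. Qed.

Lemma linear_subspaceD Z x y : linear_subspace Z -> Z x -> Z y -> Z (x + y).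
Proof. by move=> [Z0 ZD] Zx Zy; rewrite -[x]scale1r; apply: ZD. Qed.

Lemma linear_subspace_sum Z n (x : nat -> X) : linear_subspace Z ->
  (forall i, (i < n)%N -> Z (x i)) -> Z (\sum_(i < n) x i).
Proof.
move=> ZS; elim: n => [|n IH] Zx; first by rewrite big_ord0; exact: ZS.1.
rewrite big_ord_recr /=; apply: linear_subspaceD => //; last exact: Zx.
by apply: IH => i ni; apply: Zx; rewrite ltnW.
Qed.

(** A spanning family of [S] together with representatives of the classes
    modulo [S] would span [Y]. *)
Lemma finite_codim_infinite Y S : infinite_dimensional Y ->
  finite_codim_subspace Y S -> infinite_dimensional S.
Proof.
move=> Yinf [_ SY [n [v [Yv vP]]]] [m [w [Sw wP]]]; apply: Yinf.
exists (n + m)%N, (fun i => match fintype.split i with inl j => v j | inr k => w k end).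
split.
  by move=> i; case: splitP => j _; [exact: Yv|exact/SY/Sw].
move=> y /vP[a /wP[b E]].
exists (fun i => match fintype.split i with inl j => a j | inr k => b k end).
rewrite big_split_ord /=.
under eq_bigr do rewrite (unsplitK (inl _)).
under [X in _ + X]eq_bigr do rewrite (unsplitK (inr _)).
by rewrite -E addrC subrK.
Qed.

End Dimension.

Section Asymptotic.
Variable R : realType.
Local Notation X := (avg_space R).
Local Notation vec := (nat -> R).
Implicit Types (Z : set X) (c e : R).

Lemma valBZ (x y : X) (r : R) k : val (x - r *: y) k = val x k - r * val y k.
Proof.
by []. Qed.

Lemma zero_before_scaled_sum n k (x : nat -> X) (r : R) :
  (forall i, (i < n)%N -> zero_before k (x i)) ->
  zero_before k (r *: \sum_(i < n) x i).
Proof.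
move=> x0 j jk; rewrite linearZ /= scalrfctE val_sum fct_sumE big1 ?scaler0 //.
by move=> i _; apply: x0.
Qed.

(** Prescribing one more zero coordinate lowers the dimension by at most one. *)
Lemma infinite_zero_before Z N : linear_subspace Z -> infinite_dimensional Z ->
  infinite_dimensional [set x | Z x /\ zero_before N x].
Proof.
move=> ZS Zinf; elim: N => [|N IH].
  rewrite (_ : [set x | _] = Z) //; apply/seteqP; split=> x /=; first by case.
  by move=> Zx; split.
move=> [n [v [vZ vP]]]; apply: IH.
have [[w [Zw w0] wN]|no] := pselect (exists2 w, Z w /\ zero_before N w & val w N != 0).
  exists n.+1, (fun i => if unlift ord0 i is Some j then v j else w); split.
    move=> i; case: unliftP => [j _|_ //]; have [Zv v0] := vZ j.
    by split => // k kN; apply: v0; rewrite ltnW.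
  move=> y [Zy y0].
  pose r := val y N / val w N.
  have /vP[a E] : Z (y - r *: w) /\ zero_before N.+1 (y - r *: w).
    split; first by rewrite addrC -scaleNr; exact: ZS.2.
    move=> k; rewrite ltnS leq_eqVlt => /orP[/eqP->|kN].
      by rewrite valBZ /r divfK // subrr.
    by rewrite valBZ y0 // w0 // mulr0 subrr.
  exists (fun i => if unlift ord0 i is Some j then a j else r).
  rewrite big_ord_recl unlift_none.
  under eq_bigr do rewrite liftK.
  by rewrite -E addrC subrK.
exists n, v; split.
  by move=> i; have [Zv v0] := vZ i; split=> // k kN; apply: v0; rewrite ltnW.
move=> y [Zy y0]; apply: vP; split=> // k; rewrite ltnS leq_eqVlt => /orP[/eqP->|/y0//].
by apply: contrapT => /eqP yN; apply: no; exists y.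
Qed.

Lemma exists_zero_before Z N : linear_subspace Z -> infinite_dimensional Z ->
  exists y, [/\ Z y, `|y| = 1 & zero_before N y].
Proof.
move=> ZS Zinf; have Ninf := infinite_zero_before (N := N) ZS Zinf.
have [[y [Zy y0] yn0]|no] := pselect (exists2 y, Z y /\ zero_before N y & y != 0).
  exists (`|y|^-1 *: y); split; first exact: linear_subspaceZ.
    by rewrite normrZ normfV normr_id mulVf // normr_eq0.
  by move=> k kN; rewrite linearZ /= fctE y0 // scaler0.
exfalso; apply: Ninf; exists 0%N, (fun=> 0); split; first by case.
move=> y yP; exists (fun=> 0); rewrite big_ord0.
by apply: contrapT => /eqP yn0; apply: no; exists y.
Qed.

(** Vectors of this kind, chosen successively, dominate a multiple of the
    basis of [l_1^n] for all [n]. *)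
Definition has_l1_averages Z c := forall N, exists y b h,
  [/\ Z y, `|y| = 1, zero_before N y, fast N 1 N b h & c <= h (val y)].

(** The threshold [s] for the sizes does not depend on the number [K] of
    averages: the averages behind the first one that reaches [y] have sizes beyond
    the beginning of the support of [y] anyway, and this can be chosen after [K].
    In [upper_blocks] the sizes are only known to exceed the beginning of the very
    first block. *)
Definition has_c0_vectors Z e s := forall K, exists y,
  [/\ Z y, `|y| = 1, zero_before K y &
    forall a d b h, (s <= a)%N -> (d <= K)%N -> fast a d a b h ->
      `|h (val y)| <= e].

Lemma fast_le (v : vec) p (r : R) :
  (forall b h, fast p 1 p b h -> `|h v| <= r) ->
  forall s d a b h, fast s d a b h -> (p <= s)%N -> (p <= a)%N ->
    `|h v| <= d%:R * r.
Proof.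
move=> H s d a b h.
have r0 : 0 <= r by have := H p _ (fast0 _ _ _ _ _); rewrite normr0.
elim=> {s d a b h} [s d a b _ _|s d a c b t g h acb st gA hF IH ps pa].
  by rewrite normr0 mulr_ge0.
apply: (le_trans (ler_normD _ _)); rewrite -natr1 mulrDl mul1r addrC.
apply: lerD; first by apply: IH; lia.
have hF1 : fast p 1 p c (fun x => t%:R^-1 * g x + 0).
  apply: (@fast_cons _ _ _ _ c _ _ _ (fun=> 0)); [lia|lia| |exact: fast0].
  by apply: (packed_widen gA).
by have := H _ _ hF1; rewrite addr0.
Qed.

Lemma fast1_inv s d a b (h : vec -> R) : fast s d a b h ->
  (d = 0%N -> forall x, h x = 0) /\
  (d = 1%N -> exists t g, [/\ (s <= t)%N, packed t a b g &
     forall x, h x = t%:R^-1 * g x]).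
Proof.
elim=> {s d a b h} [s d a b|s d a c b t g h acb st gA hF [IH _]].
  split=> // _; exists s, (fun=> 0); split=> // [|x]; first exact: packed0.
  by rewrite mulr0.
split=> // -[d0]; exists t, g; split=> // [|x]; last by rewrite (IH d0) addr0.
by apply: (packed_widen gA) => //; lia.
Qed.

(** Any normalized vector far enough out will do: its first average is
    controlled by the failure for [e / 2], the remaining at most [K] ones, of much
    larger sizes, by the failure for [e / (2 (K + 1))]. *)
Lemma no_l1_averages Z : linear_subspace Z -> infinite_dimensional Z ->
  (forall c, 0 < c -> ~ has_l1_averages Z c) ->
  forall e, 0 < e -> exists s, has_c0_vectors Z e s.
Proof.
move=> ZS Zinf no.
have {}no c : 0 < c -> exists N, forall y b h, Z y -> `|y| = 1 ->
    zero_before N y -> fast N 1 N b h -> `|h (val y)| <= c.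
  move=> c0; apply: contrapT => /forallNP H; apply: (no c c0) => N.
  apply: contrapT => H2; apply: (H N) => y b h Zy y1 y0 hF.
  rewrite leNgt; apply/negP => ch; apply: H2; exists y, b.
  have [h0|h0] := leP 0 (h (val y)).
    by exists h; split=> //; rewrite ltW // -(ger0_norm h0).
  exists (fun x => -1 * h x); split=> //.
    by apply: fast_scale => //; rewrite normrN1.
  by rewrite mulN1r ltW // -(ltr0_norm h0).
move=> e e0; have e20 : 0 < e / 2 by rewrite divr_gt0.
have [N1 N1P] := no _ e20; exists N1 => K.
have eK : 0 < e / 2 / K.+1%:R by rewrite divr_gt0 // ltr0n.
have [N2 N2P] := no _ eK.
have [y [Zy y1 y0]] := exists_zero_before (maxn K (maxn N1 N2)) ZS Zinf.
have z M : (M <= maxn K (maxn N1 N2))%N -> zero_before M y.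
  by move=> MK k kM; apply: y0; exact: leq_trans MK.
exists y; split => //; first by apply: z; rewrite leq_maxl.
move=> a d b h Na dK hF.
rewrite (splitr e).
apply: (fast_first_rest (p := maxn K (maxn N1 N2)) (s0 := N1) (d := K) y0
  (ltW e20) (ltW e20) _ _ dK Na hF).
  move=> {}a {}b {}h {}Na {}hF; apply: (N1P _ b) => //; first by apply: z; lia.
  by apply: (fast_widen hF).
move=> {}b {}h {}hF.
apply: (@le_trans _ _ (K%:R * (e / 2 / K.+1%:R))).
  apply: (fast_le (p := maxn K (maxn N1 N2)) _ hF) => //.
  move=> b' h' hF'; apply: (N2P _ b') => //; first by apply: z; lia.
  by apply: (fast_widen hF'); lia.
rewrite mulrCA ler_piMr ?(ltW e20) // ler_pdivrMr ?ltr0n // mul1r ler_nat.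
exact: leqnSn.
Qed.

(** Take [m] successive [l_1] averages [x i], of total norm at least [m c / 2].
    An average of size [t] is at most about [1 + m / t] on their sum, so at most a
    multiple of [1 / m + 1 / t] on the normalized sum.  The threshold [s] depends
    on [c] and [e] but not on [Z], which is what lets player (V) use it in a game
    where the subspaces are not known in advance. *)
Lemma averages_c0 c e : 0 < c -> 0 < e -> exists s,
  forall Z, linear_subspace Z -> has_l1_averages Z c -> has_c0_vectors Z e s.
Proof.
move=> c0 e0.
(* For m >= Q k, an average of size at least Q k is at most e / (2 (k + 1)) on the
   normalized sum: k = 0 is used for one average, k = K for up to K of them. *)
pose Q (K : nat) := 16 * K.+1%:R / (c * e) : R.
have ce0 : 0 < c * e by rewrite mulr_gt0.
have Q0 k : 0 <= Q k by rewrite /Q divr_ge0 ?mulr_ge0 // ltW.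
have large k : exists2 m, (1 < m)%N & Q k <= m%:R.
  exists (maxn 2 (Num.bound (Q k))); first by rewrite leq_max.
  apply: ltW; apply: (lt_le_trans (archi_boundP (Q0 k))).
  by rewrite ler_nat leq_maxr.
have [s s1 sQ] := large 0%N; exists s => Z ZS Zl1 K.
have c1 : c <= 1.
  have [y [b [h [_ y1 _ hF hc]]]] := Zl1 2%N.
  have /space_norm_ge hy := fast_norming (leqnn 2) (leqnn 2) hF.
  by apply: (le_trans hc); rewrite -y1; apply: (le_trans (ler_norm _)); exact: hy.
have [m m1 mQ] := large K.
have m0 : 0 < m%:R :> R by rewrite ltr0n ltnW.
pose dl := c / (2 * m%:R).
have dl0 : 0 < dl by rewrite divr_gt0 ?mulr_gt0.
have [_ q|x [q [q0 xq]]] := @chain X (fun _ q x q' =>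
  [/\ Z x, `|x| = 1, block q x q' dl &
     exists2 h, fast q 1 q q' h & c <= h (val x)]) _ (maxn K m.+1).
  have [y [b [h [Zy y1 y0 hF hc]]]] := Zl1 q.
  have [q' [qq bq yq]] := block_exists b y0 dl0.
  exists y, q'; split=> //; split=> //; exists h => //.
  by apply: (fast_widen hF).
have q_mono i : (q i <= q i.+1)%N by case: (xq i).
have x_block i : (i < m)%N -> block (q i) (x i) (q i.+1) dl.
  by case: (xq i) => _ [].
have /choice[h hP] : forall i, exists h,
    fast (q i) 1 (q i) (q i.+1) h /\ c <= h (val (x i)).
  by move=> i; case: (xq i) => _ [_ _ _ [h ? ?]]; exists h.
pose y := \sum_(i < m) x i.
have mdl : m%:R * dl = c / 2 by rewrite /dl; field; rewrite gt_eqF.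
have ylow : m%:R * c / 2 <= `|y|.
  have dq : (\sum_(i < m) 1 < q 0)%N by rewrite sum1_card card_ord q0 leq_maxr.
  have q1 : (1 < q 0)%N by rewrite q0 leq_max ltnS (ltnW m1) orbT.
  apply: le_trans (lower_blocks q_mono x_block q1 dq (fun i _ => (hP i).1)).
  rewrite mdl.
  have : \sum_(i < m) c <= \sum_(i < m) h i (val (x i)).
    by apply: ler_sum => i _; exact: (hP i).2.
  rewrite sumr_const card_ord mulr_natl.
  have : c <= m%:R * c by rewrite ler_peMl ?(ltW c0) // ler1n ltnW.
  rewrite -mulr_natl; lra.
have y0 : 0 < `|y| by apply: lt_le_trans ylow; rewrite divr_gt0 ?mulr_gt0.
have avg a b h' : (1 < a)%N -> fast a 1 a b h' ->
    `|h' (val (`|y|^-1 *: y))| <= 4 / (m%:R * c) + 2 / (a%:R * c).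
  move=> a1 hF; have [_ /(_ erefl)[t [g [at_ gP hE]]]] := fast1_inv hF.
  have a0 : 0 < a%:R :> R by rewrite ltr0n ltnW.
  have hy : `|h' (val y)| <= 2 + m%:R / a%:R.
    have t1 : (1 < t)%N by exact: leq_trans at_.
    have x1 i : (i < m)%N -> `|x i| <= 1 by case: (xq i) => _ [_ ->].
    rewrite hE /y val_sum.
    apply: (le_trans (packed_block_sum q_mono x_block a1 t1 x1 gP)).
    rewrite mdl.
    have : m%:R / t%:R <= m%:R / a%:R :> R.
      by rewrite ler_pM2l // lef_pV2 ?posrE ?ltr0n ?ler_nat // ltnW.
    lra.
  rewrite linearZ /= (linZ _ _ (fast_linear hF)) normrM normfV normr_id.
  rewrite mulrC ler_pdivrMr //; apply: (le_trans hy).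
  apply: (@le_trans _ _ ((4 / (m%:R * c) + 2 / (a%:R * c)) * (m%:R * c / 2))).
    rewrite le_eqVlt; apply/orP; left; apply/eqP; field.
    by rewrite !gt_eqF.
  rewrite ler_wpM2l // addr_ge0 // divr_ge0 // ltW // mulr_gt0 //.
have mb : 4 / (m%:R * c) <= e / 4 / K.+1%:R.
  rewrite ler_pdivrMr ?mulr_gt0 //; rewrite /Q ler_pdivrMr // in mQ.
  rewrite mulrAC ler_pdivlMr ?ltr0n //; move: mQ; lra.
have ab N a : (0 < a)%N -> Q N <= a%:R -> 2 / (a%:R * c) <= e / 8 / N.+1%:R.
  move=> a0; rewrite -(ltr0n R) in a0; rewrite /Q ler_pdivrMr // => aQ.
  rewrite ler_pdivrMr ?mulr_gt0 //.
  rewrite mulrAC ler_pdivlMr ?ltr0n //; move: aQ; lra.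
have yn : `| `|y|^-1 *: y | = 1 by rewrite normrZ normfV normr_id mulVf // gt_eqF.
have Zy : Z (`|y|^-1 *: y).
  apply: linear_subspaceZ => //; apply: (linear_subspace_sum (x := x)) => // i _.
  by case: (xq i) => _ [].
have q_homo i j : (i <= j)%N -> (q i <= q j)%N.
  exact: (homo_leq leqnn (fun y x z => @leq_trans y x z) q_mono).
have y00 : zero_before (q 0) (`|y|^-1 *: y).
  apply: (zero_before_scaled_sum (x := x)) => i _ k kq.
  case: (xq i) => _ [_ _ [+ _] _]; apply.
  by apply: (leq_trans kq); exact: q_homo.
exists (`|y|^-1 *: y); split => //.
  by move=> k kK; apply: y00; rewrite q0 leq_max kK.
move=> a d b h' sa dK hF; rewrite (splitr e).
have e20 : 0 <= e / 2 by rewrite ltW // divr_gt0.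
have K1 : 1 <= K.+1%:R :> R by rewrite ler1n.
apply: (fast_first_rest (p := q 0) (d := K) y00 e20 e20 _ _ dK sa hF).
  move=> {}a {}b {}h' {}sa {}hF.
  have a1 : (1 < a)%N by exact: leq_trans sa.
  apply: (le_trans (avg _ _ _ a1 hF)); have /ab : (0 < a)%N by exact: ltnW.
  move=> /(_ 0%N); rewrite divr1 => H.
  have {}H : 2 / (a%:R * c) <= e / 8.
    by apply: H; apply: (le_trans sQ); rewrite ler_nat.
  have H2 : e / 4 / K.+1%:R <= e / 4.
    by rewrite ler_piMr ?invf_le1 ?ltr0n // divr_ge0 // ltW.
  apply: (le_trans (lerD (le_trans mb H2) H)); move: e0; clear; lra.
move=> {}b {}h' {}hF.
have q02 : (1 < q 0)%N by rewrite q0 leq_max ltnS (ltnW m1) orbT.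
have mq : m%:R <= (q 0)%:R :> R by rewrite ler_nat q0 leq_max leqnSn orbT.
have H : forall b h, fast (q 0) 1 (q 0) b h ->
    `|h (val (`|y|^-1 *: y))| <= e / 2 / K.+1%:R.
  move=> b' h'' hF'; apply: (le_trans (avg _ _ _ q02 hF')).
  apply: (le_trans (lerD mb (ab K (q 0%N) (ltnW q02) (le_trans mQ mq)))).
  by rewrite -mulrDl ler_wpM2r ?invr_ge0 //; move: e0; clear; lra.
apply: (le_trans (fast_le H hF _ _)) => //.
rewrite mulrCA ler_piMr // ler_pdivrMr ?ltr0n // mul1r ler_nat.
exact: leqnSn.
Qed.

(** The sum of [n] successive [c_0] vectors with errors [1 / n] has norm at
    most 4 by [upper_blocks], and the mean of functionals norming the terms is at
    least [1 / 4] on it. *)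
Lemma c0_vectors_l1 Z : linear_subspace Z ->
  (forall e, 0 < e -> exists s, has_c0_vectors Z e s) ->
  has_l1_averages Z (1 / 16).
Proof.
move=> ZS Zc0 N.
have [n [n1 Nn]] : exists n, (1 < n)%N /\ (N <= n)%N.
  by exists (maxn N 2); rewrite leq_maxr leq_maxl.
have n0 : 0 < n%:R :> R by rewrite ltr0n ltnW.
have en0 : 0 < n%:R^-1 :> R by rewrite invr_gt0.
have [s sP] := Zc0 _ en0.
pose dl : R := n%:R^-1 / 4.
have dl0 : 0 < dl by rewrite divr_gt0.
have ndl : n%:R * dl = 1 / 4 by rewrite /dl; field; rewrite gt_eqF.
have dl1 : dl <= 1 / 4.
  have : n%:R^-1 <= 1 :> R by rewrite invf_le1 // ler1n ltnW.
  by rewrite /dl; clear; lra.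
have [_ q|x [q [q0 xq]]] := @chain X (fun _ q x q' =>
  [/\ Z x, `|x| = 1, block q x q' dl &
     forall a d b h, (s <= a)%N -> (d <= q)%N -> fast a d a b h ->
       `|h (val x)| <= n%:R^-1]) _ (maxn s (maxn N 2)).
  have [y [Zy y1 y0 hy]] := sP q.
  have [q' [qq bq yq]] := block_exists 0 y0 dl0.
  by exists y, q'; split.
have q_mono i : (q i <= q i.+1)%N by case: (xq i).
have x_block i : (i < n)%N -> block (q i) (x i) (q i.+1) dl.
  by case: (xq i) => _ [].
pose y := \sum_(i < n) x i.
have yup : `|y| <= 4.
  apply: le_trans (upper_blocks (lam := fun=> n%:R^-1) q_mono x_block (@ler01 R) _ _ _) _.
  - by move=> i _; case: (xq i) => _ [_ ->].
  - by move=> i; exact: ltW.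
  - move=> i a d b h _ qa dq hF; case: (xq i) => _ [_ _ _ H].
    apply: (H a d b) => //; apply: leq_trans qa; by rewrite q0 leq_maxl.
  by rewrite ndl sumr_const card_ord -[_ *+ n]mulr_natr mulVf ?gt_eqF //; clear; lra.
have /choice[f fP] : forall i, exists f, norming (q i) (q i.+1) f /\
    1 / 2 <= f (val (x i)).
  move=> i; have [qi [_ x1 [x0 xt] _]] := xq i.
  have : 3 / 4 < space_norm (x i) by rewrite -[space_norm _]/(`|x i|) x1; lra.
  move=> /space_norm_gt[a [b [f [fn fx]]]].
  exists (fun y => f (chop (fun k => q i <= k < q i.+1)%N y)).
  split; first exact: (norming_restrict qi fn).
  have := block_approx (conj x0 xt) fn.
  rewrite (linB _ _ (norming_linear fn)) ler_norml => /andP[_].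
  move: fx dl1; lra.
have q01 : (1 < q 0)%N by rewrite q0 !leq_max leqnn !orbT.
have Nq : (N <= q 0)%N by rewrite q0 !leq_max leqnn orbT.
have [h hF hy] := average_blocks q_mono x_block n1 q01 (fun i _ => (fP i).1).
have {}hy : 1 / 4 <= h (val y).
  apply: le_trans hy; rewrite ndl.
  have : \sum_(i < n) (1 / 2) <= \sum_(i < n) f i (val (x i)).
    by apply: ler_sum => i _; exact: (fP i).2.
  rewrite sumr_const card_ord -[_ *+ n]mulr_natl => H.
  have : 1 / 2 <= n%:R^-1 * \sum_(i < n) f i (val (x i)).
    by rewrite ler_pdivlMl.
  lra.
have y0 : 0 < `|y|.
  rewrite normr_gt0; apply/negP => /eqP y0; move: hy.
  rewrite y0 raddf0 (lin0 (fast_linear hF)); lra.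
exists (`|y|^-1 *: y), (q n), h; split.
- apply: linear_subspaceZ => //; apply: (linear_subspace_sum (x := x)) => // i _.
  by case: (xq i) => _ [].
- by rewrite normrZ normfV normr_id mulVf // gt_eqF.
- apply: (zero_before_scaled_sum (x := x)) => i _ k kN.
  case: (xq i) => _ [_ _ [+ _] _]; apply.
  apply: (leq_trans (leq_trans kN Nq)).
  exact: (homo_leq leqnn (fun y x z => @leq_trans y x z) q_mono).
- exact: (fast_widen hF).
rewrite linearZ /= (linZ _ _ (fast_linear hF)) [leRHS]mulrC ler_pdivlMr //.
apply: le_trans hy; move: yup; lra.
Qed.

(** Either there are [l_1] averages for some constant, and their means are
    [c_0] vectors, or there are none, and all vectors far out are [c_0] vectors.
    The passage through [c_0] vectors replaces the constant that depends on [Z]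
    by a universal one. *)
Lemma l1_averages Z : linear_subspace Z -> infinite_dimensional Z ->
  has_l1_averages Z (1 / 16).
Proof.
move=> ZS Zinf; apply: c0_vectors_l1 => // e e0.
have [[c c0 Zc]|no] := pselect (exists2 c, 0 < c & has_l1_averages Z c).
  by have [s sP] := averages_c0 c0 e0; exists s; exact: sP.
by apply: no_l1_averages e0 => // c c0 Zc; apply: no; exists c.
Qed.

Lemma uniform_c0_vectors e : 0 < e -> exists s,
  forall Z, linear_subspace Z -> infinite_dimensional Z -> has_c0_vectors Z e s.
Proof.
move=> e0; have c0 : 0 < 1 / 16 :> R by lra.
have [s sP] := averages_c0 c0 e0.
by exists s => Z ZS Zinf; apply: sP => //; exact: l1_averages.
Qed.

End Asymptotic.

(** * The game *)

Section Game.
Variable R : realType.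

(** Player (V) answers with blocks placed one behind the other; this is possible
    because each move of (S) is again an infinite dimensional subspace. *)
Lemma play_game (X : normedModType R) (Y : set X) n (normE : 'rV[R]_n -> R)
    (C : R) (Q : nat -> X -> nat -> Prop) (q0 : nat) :
  infinite_dimensional Y ->
  S_has_winning_strategy Y normE C ->
  (forall Z, linear_subspace Z -> infinite_dimensional Z -> forall q, exists x q',
     [/\ (q <= q')%N, Z x, `|x| = 1 & Q q x q']) ->
  exists (x : nat -> X) (q : nat -> nat),
    [/\ q 0%N = q0,
        forall i, [/\ (q i <= q i.+1)%N, `|x i| = 1 & Q (q i) (x i) (q i.+1)] &
        C_equivalent Num.norm normE (fun i : 'I_n => x i)
          (@unit_vector_basis R n) C].
Proof.
move=> Yinf [S [Scodim win]] step.
have [s q|x [q [q00 xq]]] := @chain X (fun s q x q' =>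
    [/\ S s x, `|x| = 1 & Q q x q']) _ q0.
  have Ssub : linear_subspace (S s).
    by case: (Scodim s) => Sc _ _; exact: closed_subspace_linear.
  have Sinf := finite_codim_infinite Yinf (Scodim s).
  have [x [q' [qq Sx x1 xQ]]] := step _ Ssub Sinf q.
  by exists x, q'.
exists x, q; split=> //; first by move=> i; case: (xq i) => qi [_ x1 xQ].
have tE : tnth [tuple of mkseq x n] = (fun i : 'I_n => x i).
  by apply/funext => i; rewrite (tnth_nth 0) /= nth_mkseq.
rewrite -tE; apply: win => k; rewrite tE.
rewrite (_ : take k _ = mkseq x k); last first.
  by rewrite /= /mkseq -map_take take_iota (minn_idPl _) // ltnW.
by case: (xq k) => _ [].
Qed.

(** Comparing normalized first vectors shows that both constants of the
    equivalence are at least 1, hence each of them is at most [C]. *)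
Lemma C_equivalent_sums (X : normedModType R) n (normE : 'rV[R]_n.+1 -> R)
    (C : R) (x : 'I_n.+1 -> X) :
  C_equivalent Num.norm normE x (@unit_vector_basis R n.+1) C ->
  `|x ord0| = 1 -> normE (@unit_vector_basis R n.+1 ord0) = 1 ->
  0 <= normE (\sum_i @unit_vector_basis R n.+1 i) ->
  normE (\sum_i @unit_vector_basis R n.+1 i) <= C * `|\sum_i x i| /\
  `|\sum_i x i| <= C * normE (\sum_i @unit_vector_basis R n.+1 i).
Proof.
move=> [A [B [A0 B0 ABC H]]] x1 e1 s0.
have sum1 (V : lmodType R) (v : 'I_n.+1 -> V) : \sum_i 1 *: v i = \sum_i v i.
  by apply: eq_bigr => i _; rewrite scale1r.
have sum0 (V : lmodType R) (v : 'I_n.+1 -> V) :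
    \sum_i (i == ord0)%:R *: v i = v ord0.
  rewrite (bigD1 ord0) //= scale1r big1 ?addr0 // => i /negbTE ->.
  by rewrite scale0r.
have := H (fun i => (i == ord0)%:R); rewrite !sum0 x1 e1 !mulr1 => /andP[A1 B1].
have {}A1 : 1 <= A by rewrite -invf_le1.
have AC : A <= C by apply: le_trans ABC; rewrite ler_peMr // ltW.
have BC : B <= C by apply: le_trans ABC; rewrite ler_peMl // ltW.
have := H (fun=> 1); rewrite !sum1 => /andP[HA HB]; split.
  by apply: (le_trans HB); rewrite ler_wpM2r.
by move: HA; rewrite ler_pdivrMl // => /le_trans; apply; rewrite ler_wpM2r.
Qed.

Lemma sum_basisE n (i : 'I_n) : (\sum_j @unit_vector_basis R n j) 0 i = 1.
Proof.
rewrite summxE (bigD1 i) //= mxE !eqxx big1 ?addr0 // => j ji.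
by rewrite mxE eqxx /= eq_sym (negbTE ji).
Qed.

Lemma lp_norm_sum_basis (p : R) n :
  lp_norm p (\sum_j @unit_vector_basis R n j) = n%:R `^ p^-1.
Proof.
rewrite /lp_norm; under eq_bigr do rewrite sum_basisE normr1 powR1.
by rewrite sumr_const card_ord.
Qed.

Lemma lp_norm_basis (p : R) n (i : 'I_n) : 0 < p ->
  lp_norm p (@unit_vector_basis R n i) = 1.
Proof.
move=> p0; rewrite /lp_norm (bigD1 i) //= big1 ?addr0.
  by rewrite mxE !eqxx /= normr1 !powR1.
move=> j ji; rewrite mxE eqxx /= (negbTE ji) normr0 powR0 //.
by rewrite gt_eqF.
Qed.

Lemma linfty_norm_sum_basis n :
  linfty_norm (\sum_j @unit_vector_basis R n.+1 j) = 1.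
Proof.
rewrite /linfty_norm; under eq_bigr do rewrite sum_basisE normr1.
apply/eqP; rewrite eq_le; apply/andP; split.
  by apply: bigmax_le => //; exact: ler01.
exact: (le_bigmax _ (fun=> 1) ord0).
Qed.

Lemma linfty_norm_basis n (i : 'I_n.+1) :
  linfty_norm (@unit_vector_basis R n.+1 i) = 1.
Proof.
rewrite /linfty_norm; apply/eqP; rewrite eq_le; apply/andP; split.
  apply: bigmax_le => [|j _]; first exact: ler01.
  by rewrite mxE eqxx /=; case: eqP; rewrite ?normr1 ?normr0 ?ler01.
apply: le_trans (le_bigmax _ _ i).
by rewrite mxE !eqxx normr1.
Qed.

Local Notation X := (avg_space R).

Lemma l1_game (Y : set X) n (normE : 'rV[R]_n.+1 -> R) (C : R) :
  infinite_dimensional Y ->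
  S_has_winning_strategy Y normE C ->
  normE (@unit_vector_basis R n.+1 ord0) = 1 ->
  0 <= normE (\sum_i @unit_vector_basis R n.+1 i) ->
  n.+1%:R / 32 <= C * normE (\sum_i @unit_vector_basis R n.+1 i).
Proof.
move=> Yinf Ywin e1 s0; have d0 : 0 < 1 / 32 :> R by lra.
have [Z ZS Zinf q|x [q [q00 xq xC]]] := @play_game X Y n.+1 normE C
  (fun q x q' => block q x q' (1 / 32) /\
    exists2 h, fast q 1 q q' h & 1 / 16 <= h (val x)) n.+3 Yinf Ywin.
  have [y [b [h [Zy y1 y0 hF hc]]]] := l1_averages ZS Zinf q.
  have [q' [qq bq yq]] := block_exists b y0 d0.
  exists y, q'; split=> //; split=> //; exists h => //.
  by apply: (fast_widen hF).
have x1 : `|x 0%N| = 1 by case: (xq 0%N).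
have [_] := C_equivalent_sums xC x1 e1 s0; apply: le_trans.
have /choice[h hP] : forall i, exists h,
    fast (q i) 1 (q i) (q i.+1) h /\ 1 / 16 <= h (val (x i)).
  by move=> i; case: (xq i) => _ _ [_ [h ? ?]]; exists h.
have q_mono i : (q i <= q i.+1)%N by case: (xq i).
have x_block i : (i < n.+1)%N -> block (q i) (x i) (q i.+1) (1 / 32).
  by case: (xq i) => _ _ [].
have dq : (\sum_(i < n.+1) 1 < q 0)%N by rewrite sum1_card card_ord q00.
have q1 : (1 < q 0)%N by rewrite q00.
apply: le_trans (lower_blocks q_mono x_block q1 dq (fun i _ => (hP i).1)).
have : \sum_(i < n.+1) (1 / 16) <= \sum_(i < n.+1) h i (val (x i)).
  by apply: ler_sum => i _; exact: (hP i).2.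
rewrite sumr_const card_ord -[_ *+ n.+1]mulr_natl; clear; lra.
Qed.

Lemma c0_game (Y : set X) n (normE : 'rV[R]_n.+1 -> R) (C : R) :
  infinite_dimensional Y ->
  S_has_winning_strategy Y normE C ->
  normE (@unit_vector_basis R n.+1 ord0) = 1 ->
  0 <= normE (\sum_i @unit_vector_basis R n.+1 i) ->
  0 <= C ->
  normE (\sum_i @unit_vector_basis R n.+1 i) <= C * 4.
Proof.
move=> Yinf Ywin e1 s0 C0; have d0 : 0 < n.+1%:R^-1 :> R by rewrite invr_gt0.
have [s sP] := uniform_c0_vectors d0.
have [Z ZS Zinf q|x [q [q00 xq xC]]] := @play_game X Y n.+1 normE C
  (fun q x q' => block q x q' n.+1%:R^-1 /\
    forall a d b h, (s <= a)%N -> (d <= q)%N -> fast a d a b h ->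
      `|h (val x)| <= n.+1%:R^-1) s Yinf Ywin.
  have [y [Zy y1 y0 hy]] := sP Z ZS Zinf q.
  have [q' [qq bq yq]] := block_exists 0 y0 d0.
  by exists y, q'; split.
have x1 : `|x 0%N| = 1 by case: (xq 0%N).
have [+ _] := C_equivalent_sums xC x1 e1 s0; move/le_trans; apply.
rewrite ler_wpM2l //.
have q_mono i : (q i <= q i.+1)%N by case: (xq i).
have x_block i : (i < n.+1)%N -> block (q i) (x i) (q i.+1) n.+1%:R^-1.
  by case: (xq i) => _ _ [].
apply: le_trans (upper_blocks (lam := fun=> n.+1%:R^-1) q_mono x_block (@ler01 R) _ _ _) _.
- by move=> i _; case: (xq i) => _ ->.
- by move=> i; exact: ltW.
- move=> i a d b h _ qa dq hF; case: (xq i) => _ _ [_ H].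
  by apply: (H a d b) => //; rewrite -q00.
rewrite sumr_const card_ord -[_ *+ n.+1]mulr_natr mulVf ?mulfV ?pnatr_eq0 //.
clear; lra.
Qed.

Lemma exists_natr_ge (r : R) : exists n : nat, r < n.+1%:R.
Proof.
exists (Num.bound `|r|); apply: (le_lt_trans (ler_norm _)).
by apply: (lt_le_trans (archi_boundP _)) => //; rewrite ler_nat.
Qed.

Lemma not_asymptotic_c0 (Y : set X) : infinite_dimensional Y ->
  ~ asymptotic_c0 Y.
Proof.
move=> Yinf [C Cwin]; have [n nC] := exists_natr_ge (32 * C).
have := l1_game Yinf (Cwin n.+1) (linfty_norm_basis _).
rewrite linfty_norm_sum_basis => /(_ ler01); move: nC; clear; lra.
Qed.

Lemma not_asymptotic_l1 (Y : set X) : infinite_dimensional Y ->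
  ~ asymptotic_lp 1 Y.
Proof.
move=> Yinf [C Cwin]; have [n nC] := exists_natr_ge (C * 4).
have e1 := lp_norm_basis (ord0 : 'I_n.+1) (@ltr01 R).
have := c0_game Yinf (Cwin n.+1) e1.
have := l1_game Yinf (Cwin n.+1) e1.
rewrite lp_norm_sum_basis invr1 powRr1 // => H1 H2.
have C0 : 0 <= C.
  have n0 : 0 < n.+1%:R :> R by [].
  have := H1 (ltW n0); rewrite mulrC ler_pM2r //; apply: le_trans.
  by rewrite invr_ge0.
by have := H2 (ler0n _ _) C0; rewrite leNgt nC.
Qed.

Lemma not_asymptotic_lp (Y : set X) (p : R) : infinite_dimensional Y ->
  1 < p -> ~ asymptotic_lp p Y.
Proof.
move=> Yinf p1 [C Cwin]; have p0 : 0 < p by exact: lt_trans p1.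
have r0 : 0 < 1 - p^-1 by rewrite subr_gt0 invf_lt1.
pose B : R := `|32 * C| + 1.
have B0 : 0 < B by rewrite ltr_pwDr.
have [n nC] := exists_natr_ge (B `^ (1 - p^-1)^-1).
have e1 := lp_norm_basis (ord0 : 'I_n.+1) p0.
have := l1_game Yinf (Cwin n.+1) e1.
rewrite lp_norm_sum_basis => /(_ (powR_ge0 _ _)) H.
have n0 : 0 < n.+1%:R :> R by [].
have BN : B <= n.+1%:R `^ (1 - p^-1).
  have -> : B = (B `^ (1 - p^-1)^-1) `^ (1 - p^-1).
    by rewrite -powRrM mulVf ?gt_eqF // powRr1 // ltW.
  by apply: ge0_ler_powR; rewrite ?nnegrE ?powR_ge0 ?ltW.
have E : n.+1%:R = n.+1%:R `^ (1 - p^-1) * n.+1%:R `^ p^-1 :> R.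
  by rewrite -powRD ?subrK ?powRr1 //; apply/implyP; rewrite gt_eqF.
move: H; rewrite {1}E -mulrA mulrCA.
have : 0 < n.+1%:R `^ p^-1 :> R by rewrite powR_gt0.
have : 32 * C < B by rewrite /B (le_lt_trans (ler_norm _)) // ltrDl.
move: BN; set u := _ `^ (1 - _); set w := _ `^ _ => BN CB w0.
rewrite [leLHS]mulrC ler_pM2r // => H.
move: BN CB H; clear; lra.
Qed.

End Game.

(** * Ultralimits, iterated limits and truncations *)

Section Ultra.
Variable R : realType.

Lemma ultra_cvg (T : Type) (U : set_system T) (f : T -> R) (B : R) :
  UltraFilter U -> (forall t, `|f t| <= B) -> exists l : R, f t @[t --> U] --> l.
Proof.
move=> UU fB; have UP : ProperFilter U by exact: ultra_proper.
have [l [_ lU]] : `[- B, B] `&` cluster (f @ U) !=set0.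
  apply: segment_compact; suff : U (f @^-1` `[- B, B]) by [].
  by apply: filterE => t; rewrite /= in_itv /= -ler_norml.
exists l; apply/cvgrPdist_lt => e e0.
have [//|N] := in_ultra_setVsetC [set t | `|l - f t| < e] UU.
have [r [/= rN re]] := lU (f @` ~` [set t | `|l - f t| < e]) (ball l e)
  (filterS (fun t Nt => ex_intro2 _ _ t Nt erefl) N) (nbhsx_ballx l e e0).
by case: rN => t Nt tr; case: Nt; rewrite /= tr -ball_normE in re *.
Qed.

End Ultra.

Section Choose.
Variables (R : realType) (I : eqType) (U : set_system nat).
Hypothesis UU : ProperFilter U.
Hypothesis Uoo : \oo `<=` U.

(** Indices realizing an iterated limit up to [e] are chosen in the order of
    [s], outermost first.  At each stage any requirement that holds along [U] may
    be imposed, also one that depends on the stages before through the position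
    [q k]. *)
Lemma iterated_lim_choose (F : (I -> nat) -> R)
    (good : I -> nat -> nat -> nat -> Prop) (i0 : I) :
  (forall i q, \forall m \near U, exists q', (q <= q')%N /\ good i q m q') ->
  forall s, uniq s -> forall j0 L, is_iterated_lim s F j0 L ->
  forall (e : R) q0, 0 < e -> exists j q,
    [/\ forall i, i \notin s -> j i = j0 i,
        `|F j - L| <= e, q 0%N = q0, (forall k, (q k <= q k.+1)%N) &
        forall k, (k < size s)%N ->
          good (nth i0 s k) (q k) (j (nth i0 s k)) (q k.+1)].
Proof.
move=> step; elim=> [_ j0 L /= <- e q0 e0|i s IH /= /andP[iNs us] j0 L [g [gF gL]] e q0 e0].
  by exists j0, (fun=> q0); split=> //; rewrite subrr normr0 ltW.
have e20 : 0 < e / 2 by rewrite divr_gt0.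
have gU : \forall m \near U, `|L - g m| < e / 2.
  by apply: Uoo; move/cvgrPdist_lt : gL; exact.
have [m [gm [q1 [q01 gq]]]] := filter_ex (filterI gU (step i q0)).
have [j [q [jj0 jF qq1 qm qgood]]] := IH us _ _ (gF m) (e / 2) q1 e20.
have ji : j i = m by rewrite jj0 //= eqxx.
exists j, (fun k => if k is k'.+1 then q k' else q0); split => //.
- move=> i'; rewrite inE negb_or => /andP[i'i i's].
  by rewrite jj0 //= (negbTE i'i).
- rewrite (_ : F j - L = (F j - g m) + (g m - L)); last by rewrite addrA subrK.
  rewrite (splitr e); apply: (le_trans (ler_normD _ _)); apply: lerD => //.
  by rewrite distrC ltW.
- by case=> [|k]; rewrite ?qq1.
- by case=> [|k] kn /=; [rewrite ji qq1|exact: qgood].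
Qed.

End Choose.

Section Truncation.
Variable R : realType.
Local Notation X := (avg_space R).
Local Notation vec := (nat -> R).

Lemma bounded_by_head (x : vec) q :
  bounded_by (chop (gtn q) x) (\sum_(0 <= k < q) `|x k|).
Proof.
move=> a b f fn; have [H _] := functionals_l1_bound R.
have {}fn : norming 0 (q + b) f by apply: (norming_widen fn) => //; lia.
apply: (le_trans (H _ _ _ fn _)).
rewrite (big_cat_nat (n := q)) //=; last lia.
rewrite [X in _ + X]big_nat_cond [X in _ + X]big1 ?addr0.
  rewrite big_nat_cond [leRHS]big_nat_cond; apply: ler_sum => k /andP[/andP[_ kq] _].
  by rewrite /chop /= kq.
by move=> k /andP[/andP[qk _] _]; rewrite /chop /= ltnNge qk /= normr0.
Qed.

Lemma norming_bounded_chop (A : pred nat) (x : X) :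
  norming_boundedb (chop A (val x)).
Proof.
apply/asboolP; exists `|x|; apply: bounded_by_chop.
by apply/bounded_by_norm.
Qed.

Definition space_chop (A : pred nat) (x : X) : X :=
  AvgSpace (norming_bounded_chop A x).

Lemma norm_space_chop A x : `|space_chop A x| <= `|x|.
Proof. by apply/bounded_by_norm/bounded_by_chop/bounded_by_norm. Qed.

Lemma sub_space_chop q (x : X) e : bounded_by (chop (gtn q) (val x)) e ->
  `|x - space_chop (leq q) x| <= e.
Proof.
move=> xe; apply/bounded_by_norm; rewrite raddfB /=.
rewrite (_ : _ - _ = chop (gtn q) (val x)) //.
apply/funext => k; rewrite /chop addrfctE opprfctE /= ltnNge.
by case: leqP => _ /=; rewrite ?subrr ?subr0.
Qed.

Lemma unit_vector_bounded i : norming_boundedb (fun k => (k == i)%:R : R).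
Proof.
apply/asboolP; exists (\sum_(0 <= k < i.+1) `|(k == i)%:R : R|).
rewrite (_ : (fun k => _) = chop (gtn i.+1) (fun k => (k == i)%:R)).
  exact: bounded_by_head.
apply/funext => k; rewrite /chop /=; case: ltnP => // ik.
by case: eqP => // ki; move: ik; rewrite ki ltnn.
Qed.

Definition unit_vector i : X := AvgSpace (unit_vector_bounded i).

(** If [n] vectors spanned, then the matrix expressing [n + 1] unit vectors
    through them would have a nontrivial left kernel. *)
Lemma avg_space_infinite : infinite_dimensional [set: X].
Proof.
move=> [n [v [_ vP]]].
have /choice[a aP] : forall i, exists a : 'I_n -> R,
    unit_vector i = \sum_(j < n) a j *: v j.
  by move=> i; exact: vP.
pose A : 'M[R]_(n.+1, n) := \matrix_(i, j) a i j.
have : kermx A != 0.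
  rewrite kermx_eq0 /row_free; apply/negP => /eqP rA.
  by have := rank_leq_col A; rewrite rA ltnn.
move=> /eqP; apply; apply/row_matrixP => r; rewrite row0.
have cA : row r (kermx A) *m A = 0 by rewrite -row_mul mulmx_ker row0.
set c := row r _ in cA *.
have c0 : \sum_(i < n.+1) c 0 i *: unit_vector i = 0.
  under eq_bigr do rewrite aP scaler_sumr.
  rewrite exchange_big /= big1 // => j _.
  under eq_bigr do rewrite scalerA.
  rewrite -scaler_suml.
  have := congr1 (fun M : 'rV[R]_n => M 0 j) cA; rewrite !mxE.
  under eq_bigr do rewrite [A _ _]mxE.
  by move=> ->; rewrite scale0r.
apply/rowP => i; rewrite [RHS]mxE.
have := congr1 (fun x : X => val x i) c0; rewrite val_sum fct_sumE raddf0.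
rewrite (bigD1 i) //= big1 ?addr0.
  rewrite [X in X = _ -> _](_ : _ = c 0 i * (i == i :> nat)%:R) //.
  by rewrite eqxx mulr1.
move=> k ki; rewrite [LHS](_ : _ = c 0 k * (i == k :> nat)%:R) //.
by rewrite (_ : (i == k :> nat) = false) ?mulr0 //; rewrite eq_sym; apply/negbTE.
Qed.

End Truncation.

(** * One coordinatewise null sequence *)

Section OneSequence.
Variable R : realType.
Local Notation X := (avg_space R).
Local Notation vec := (nat -> R).
Variables (U : set_system nat) (u : nat -> X) (B : R).
Hypothesis UU : UltraFilter U.
Hypothesis u0 : forall k, val (u m) k @[m --> U] --> (0 : R).
Hypothesis uB : forall m, `|u m| <= B.

Let UP : ProperFilter U. Proof. exact: ultra_proper. Qed.

Lemma near_space_chop q e : 0 < e ->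
  \forall m \near U, `|u m - space_chop (leq q) (u m)| <= e.
Proof.
move=> e0; have : \sum_(0 <= k < q) `|val (u m) k| @[m --> U] --> (0 : R).
  elim: q => [|q IH]; first by under eq_fun do rewrite big_geq //; exact: cvg_cst.
  under eq_fun do rewrite big_nat_recr //=.
  by have := cvgD IH (cvg_norm (u0 q)); rewrite normr0 addr0; apply.
move=> /cvgrPdist_le/(_ _ e0); apply: filterS => m.
rewrite sub0r normrN ger0_norm ?sumr_ge0 // => ue.
apply: sub_space_chop => a b f fn.
by apply: le_trans ue; exact: (@bounded_by_head R (val (u m)) q _ _ _ fn).
Qed.

(** The values [t] that some fixed number [d] of averages, of sizes as large as
    one likes, attain on almost all [u m]. *)
Definition attained (t : R) := exists d, forall s, \forall m \near U,
  exists b h, fast s d s b h /\ t <= h (val (u m)).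

Definition weight : R := sup attained.

Lemma attained0 : attained 0.
Proof.
by exists 0%N => s; apply: filterE => m; exists s, (fun=> 0); split => //; constructor.
Qed.

Lemma attained_le t : attained t -> t <= B.
Proof.
move=> [d /(_ d.+2) /filter_ex[m [b [h [hF]]]]] /le_trans; apply.
apply: (le_trans (ler_norm _)); apply: (le_trans _ (uB m)).
exact: (space_norm_ge _ (fast_norming _ _ hF)).
Qed.

Lemma has_sup_attained : has_sup attained.
Proof. by split; [exists 0; exact: attained0|exists B => t /attained_le]. Qed.

Lemma weight_ge0 : 0 <= weight.
Proof.
by apply: ub_le_sup; [exists B => t /attained_le|exact: attained0].
Qed.

Lemma weight_lower e : 0 < e -> exists d, forall s, \forall m \near U,
  exists b h, fast s d s b h /\ weight - e <= h (val (u m)).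
Proof.
move=> e0; have [t [d dP] te] := sup_adherent e0 has_sup_attained.
exists d => s; apply: filterS (dP s) => m [b [h [hF th]]].
by exists b, h; split => //; apply: le_trans th; exact: ltW.
Qed.

(** Since [U] is an ultrafilter, the failure of [attained (weight + e)] means that
    for each [d] and a suitable [s] the opposite inequality holds along [U]. *)
Lemma weight_upper e d : 0 < e -> exists s, \forall m \near U,
  forall b h, fast s d s b h -> `|h (val (u m))| <= weight + e.
Proof.
move=> e0; apply: contrapT => /forallNP no.
suff : attained (weight + e).
  move=> /(ub_le_sup (proj2 has_sup_attained)); rewrite -/weight.
  by rewrite gerDl leNgt e0.
exists d => s; have [//|N] := in_ultra_setVsetC [set m | forall b h,
  fast s d s b h -> `|h (val (u m))| <= weight + e] UU; first by move=> /no.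
apply: filterS N => m /= Hm; apply: contrapT => Hn; apply: Hm => b h hF.
rewrite leNgt; apply/negP => lt; apply: Hn; exists b.
have [h0|h0] := leP 0 (h (val (u m))).
  by exists h; split=> //; rewrite ltW // -(ger0_norm h0).
exists (fun x => -1 * h x); split.
  by apply: fast_scale => //; rewrite normrN1.
by rewrite mulN1r ltW // -(ltr0_norm h0).
Qed.

Variable M : R.
Hypothesis uM : `|u m| @[m --> U] --> M.

Definition upper_block q0 e q m q' := exists w : X,
  [/\ block q w q' e, `|u m - w| <= e, `|w| <= M + e &
    forall a d b h, (q0 <= a)%N -> (d <= q)%N -> fast a d a b h ->
      `|h (val w)| <= 2 * (weight + e)].

Definition lower_block e d q m q' := exists (w : X) h,
  [/\ block q w q' e, `|u m - w| <= e, M - e <= `|u m|, fast q d q q' h &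
    weight - e <= h (val w)].

(** The sizes in question are at least [s], which settles the first average that
    reaches the block; the remaining averages, at most [q] of them, have sizes
    beyond the start of the block, which is moved out after [q] is known. *)
Lemma near_upper_block e : 0 < e -> exists s, forall q0, (s <= q0)%N ->
  forall q, \forall m \near U, exists q', (q <= q')%N /\ upper_block q0 e q m q'.
Proof.
move=> e0; have [s1 s1P] := weight_upper 1 e0; exists s1 => q0 sq q.
have [s sP] := weight_upper q e0; pose p := maxn q s.
have uMe : \forall m \near U, `|u m| <= M + e.
  move/cvgrPdist_le : uM => /(_ _ e0); apply: filterS => m.
  by rewrite ler_distlC => /andP[].
have up := near_space_chop p e0.
apply: filterS (filterI (filterI s1P sP) (filterI uMe up)) => m [[m1 ms] [mM mp]].
pose w := space_chop (leq p) (u m).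
have w0 : zero_before p w by move=> k kp; rewrite /= /chop leqNgt kp.
have wq : zero_before q w by move=> k kq; apply: w0; rewrite leq_max kq.
have [q' [qq _ wb]] := block_exists 0 wq e0.
exists q'; split=> //; exists w; split=> //.
  exact: (le_trans (norm_space_chop _ _)).
move=> a d b h qa dq hF; rewrite mulr_natl mulr2n.
have we : 0 <= weight + e by rewrite addr_ge0 ?weight_ge0 // ltW.
apply: (fast_first_rest (p := p) (s0 := q0) (d := q) w0 we we _ _ dq qa hF).
  move=> a' b' h' qa' /(fast_chop (leq p)) hF'.
  apply: (m1 b' (fun x => h' (chop (leq p) x))).
  by apply: (fast_widen hF') => //; exact: leq_trans qa'.
move=> b' h' /(fast_chop (leq p)) hF'.
apply: (ms b' (fun x => h' (chop (leq p) x))).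
by apply: (fast_widen hF') => //; rewrite leq_maxr.
Qed.

Lemma near_lower_block e : 0 < e -> exists d, 
  forall q, \forall m \near U, exists q', (q <= q')%N /\ lower_block e d q m q'.
Proof.
move=> e0; have [d dP] := weight_lower e0; exists d => q.
have uMe : \forall m \near U, M - e <= `|u m|.
  move/cvgrPdist_le : uM => /(_ _ e0); apply: filterS => m.
  by rewrite ler_distlC => /andP[].
have up := near_space_chop q e0.
apply: filterS (filterI (dP q) (filterI uMe up)) => m [[b [h [hF hl]]] [mM mp]].
pose w := space_chop (leq q) (u m).
have w0 : zero_before q w by move=> k kp; rewrite /= /chop leqNgt kp.
have [q' [qq bq wb]] := block_exists b w0 e0.
exists q'; split=> //; exists w, h; split=> //; first exact: (fast_widen hF).
rewrite (_ : h (val w) = h (val (u m))) //.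
by apply: (fast_local hF) => k /andP[qk _]; rewrite /= /chop qk.
Qed.

End OneSequence.

(** * Iterated limits of sums *)

Section Family.
Variable R : realType.
Local Notation X := (avg_space R).
Local Notation vec := (nat -> R).
Variables (U : set_system nat) (l : nat).
Local Notation n := l.+1.
Variables (x : 'I_n -> nat -> X) (z : 'I_n -> X) (B M : 'I_n -> R).
Hypothesis UU : UltraFilter U.
Hypothesis Uoo : \oo `<=` U.
Let u i m := x i m - z i.
Hypothesis u0 : forall i k, val (u i m) k @[m --> U] --> (0 : R).
Hypothesis uB : forall i m, `|u i m| <= B i.
Hypothesis uM : forall i, `|u i m| @[m --> U] --> M i.

Let UP : ProperFilter U. Proof. exact: ultra_proper. Qed.

Let F (j : 'I_n -> nat) := `|\sum_(i < n) x i (j i)|.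
Let zs := \sum_(i < n) z i.
Let Mx := \big[Num.max/0]_(i < n) M i.
Let lam i := weight U (u i).

(** It is invariant under permutations of the sequences, and all iterated limits
    are equivalent to it. *)
Definition size_estimate : R := `|zs| + Mx + 4 * \sum_(i < n) lam i.

Lemma sum_reindex (V : nmodType) (s : seq 'I_n) (G : 'I_n -> V) :
  perm_eq s (enum 'I_n) ->
  \sum_(i < n) G i = \sum_(k < n) G (nth ord0 s k).
Proof.
move=> sP; rewrite -[LHS]big_enum -(perm_big _ sP) /= (big_nth ord0) big_mkord.
by rewrite (perm_size sP) size_enum_ord.
Qed.

Let sum_split j : \sum_(i < n) x i (j i) = zs + \sum_(i < n) u i (j i).
Proof.
by rewrite /zs -big_split /=; apply: eq_bigr => i _; rewrite addrC subrK.
Qed.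

Let sum_approx (s : seq 'I_n) (j : 'I_n -> nat) (w : nat -> X) e :
  perm_eq s (enum 'I_n) ->
  (forall k, (k < n)%N -> `|u (nth ord0 s k) (j (nth ord0 s k)) - w k| <= e) ->
  `|\sum_(i < n) u i (j i) - \sum_(k < n) w k| <= n%:R * e.
Proof.
move=> sP uw; rewrite (sum_reindex _ sP) -sumrB.
apply: (le_trans (ler_norm_sum _ _ _)).
have -> : n%:R * e = \sum_(k < n) e by rewrite sumr_const card_ord mulr_natl.
by apply: ler_sum => k _; exact: uw.
Qed.

Lemma iterated_lim_le (s : seq 'I_n) L : perm_eq s (enum 'I_n) ->
  is_iterated_lim s F (fun=> 0%N) L -> L <= size_estimate.
Proof.
move=> sP sL.
have us : uniq s by rewrite (perm_uniq sP) enum_uniq.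
have ss : size s = n by rewrite (perm_size sP) size_enum_ord.
suff main e : 0 < e -> L <= size_estimate + (2 + 6 * n%:R) * e.
  apply/ler_addgt0Pr => e e0.
  have c0 : 0 < 2 + 6 * n%:R :> R by rewrite addr_gt0 ?mulr_gt0.
  have := main (e / (2 + 6 * n%:R)) (divr_gt0 e0 c0).
  by rewrite mulrCA mulfV ?mulr1 // gt_eqF.
move=> e0.
have /choice[p pP] i := near_upper_block UU (@u0 i) (uB i) (@uM i) e0.
pose q0 := (\max_(i < n) p i)%N.
have step i q : \forall m \near U, exists q', (q <= q')%N /\
    upper_block U (u i) (M i) q0 e q m q'.
  by apply: pP; rewrite /q0 leq_bigmax.
have [j [q [_ jL qq0 q_mono qP]]] :=
  iterated_lim_choose UP Uoo ord0 step us sL q0 e0.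
have /choice[w wP] : forall k, exists w, (k < n)%N ->
    [/\ block (q k) w (q k.+1) e,
        `|u (nth ord0 s k) (j (nth ord0 s k)) - w| <= e,
        `|w| <= M (nth ord0 s k) + e &
    forall a d b h, (q0 <= a)%N -> (d <= q k)%N -> fast a d a b h ->
      `|h (val w)| <= 2 * (lam (nth ord0 s k) + e)].
  move=> k; have [kn|nk] := ltnP k n; last by exists 0.
  by have [|w wk] := qP k; [rewrite ss|exists w].
have w_block k : (k < n)%N -> block (q k) (w k) (q k.+1) e by move=> /wP[].
have lam0 i : 0 <= lam i by exact: (weight_ge0 UU (uB i)).
have Mx0 : 0 <= Mx by rewrite /Mx; exact: bigmax_ge_id.
have wb : `|\sum_(k < n) w k| <= Mx + e +
    2 * (\sum_(k < n) 2 * (lam (nth ord0 s k) + e)) + n%:R * e.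
  apply: (upper_blocks (lam := fun k => 2 * (lam (nth ord0 s k) + e))
    q_mono w_block).
  - by rewrite addr_ge0 // ltW.
  - move=> k /wP[_ _ wM _]; apply: (le_trans wM).
    by rewrite lerD2r /Mx; exact: (le_bigmax _ M).
  - by move=> k; rewrite mulr_ge0 // addr_ge0 // ltW.
  - move=> k a d b h /wP[_ _ _ H] qa dq hF; apply: (H a d b) => //.
    by rewrite -qq0.
move: wb; rewrite -mulr_sumr big_split /= -(sum_reindex lam sP).
rewrite sumr_const card_ord -[_ *+ n]mulr_natl => wb.
have uw k : (k < n)%N -> `|u (nth ord0 s k) (j (nth ord0 s k)) - w k| <= e.
  by move=> /wP[].
have := sum_approx sP uw; set T := \sum_(i < n) _ => TW.
have T1 : `|T| <= `|\sum_(k < n) w k| + n%:R * e.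
  rewrite -[T](subrK (\sum_(k < n) w k)); apply: (le_trans (ler_normD _ _)).
  by rewrite addrC lerD.
have F1 : F j <= `|zs| + `|T| by rewrite /F sum_split; exact: ler_normD.
have L1 : L <= F j + e by move: jL; rewrite ler_distlC => /andP[_]; lra.
rewrite /size_estimate; move: wb T1 F1 L1 e0.
set S := \sum_(i < n) lam i.
lra.
Qed.

(** The first summand of [size_estimate] is at most [L], the norm of the remaining
    part of the sum is then at most [2 L], and the other two summands are at most
    this norm and 4 times this norm: [1 + 2 + 8 = 11]. *)
Lemma iterated_lim_ge (s : seq 'I_n) L : perm_eq s (enum 'I_n) ->
  is_iterated_lim s F (fun=> 0%N) L -> size_estimate <= 11 * L.
Proof.
move=> sP sL.
have us : uniq s by rewrite (perm_uniq sP) enum_uniq.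
have ss : size s = n by rewrite (perm_size sP) size_enum_ord.
suff main e : 0 < e -> size_estimate <= 11 * L + (20 + 20 * n%:R) * e.
  apply/ler_addgt0Pr => e e0.
  have c0 : 0 < 20 + 20 * n%:R :> R by rewrite addr_gt0 ?mulr_gt0.
  have := main (e / (20 + 20 * n%:R)) (divr_gt0 e0 c0).
  by rewrite mulrCA mulfV ?mulr1 // gt_eqF.
move=> e0.
have /choice[d dP] i := near_lower_block UU (@u0 i) (uB i) (@uM i) e0.
have [q1 q1P] := tail_small zs e0.
pose q0 := maxn q1 (\sum_(i < n) d i).+2.
have step i q : \forall m \near U, exists q', (q <= q')%N /\
    lower_block U (u i) (M i) e (d i) q m q' by exact: dP.
have [j [q [_ jL qq0 q_mono qP]]] :=
  iterated_lim_choose UP Uoo ord0 step us sL q0 e0.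
have /choice[w wP] : forall k, exists w : X, (k < n)%N -> exists h,
    [/\ block (q k) w (q k.+1) e,
        `|u (nth ord0 s k) (j (nth ord0 s k)) - w| <= e,
        M (nth ord0 s k) - e <= `|u (nth ord0 s k) (j (nth ord0 s k))|,
        fast (q k) (d (nth ord0 s k)) (q k) (q k.+1) h &
        lam (nth ord0 s k) - e <= h (val w)].
  move=> k; have [kn|nk] := ltnP k n; last by exists 0.
  by have [|w wk] := qP k; [rewrite ss|exists w].
have /choice[h hP] : forall k, exists h, (k < n)%N ->
    fast (q k) (d (nth ord0 s k)) (q k) (q k.+1) h /\
    lam (nth ord0 s k) - e <= h (val (w k)).
  move=> k; have [kn|nk] := ltnP k n; last by exists (fun=> 0).
  by have [h []] := wP k kn; exists h.
have w_block k : (k < n)%N -> block (q k) (w k) (q k.+1) e by move=> /wP[? []].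
have uw k : (k < n)%N -> `|u (nth ord0 s k) (j (nth ord0 s k)) - w k| <= e.
  by move=> /wP[? []].
have := sum_approx sP uw.
have FE : F j = `|zs + \sum_(i < n) u i (j i)| by rewrite /F sum_split.
move: FE; set T := \sum_(i < n) u i (j i); set W := \sum_(k < n) w k => FE TW.
have q1q : (q1 <= q 0)%N by rewrite qq0 leq_maxl.
have dq : (\sum_(k < n) d (nth ord0 s k) < q 0)%N.
  by rewrite -(sum_reindex d sP) qq0 leq_max leqnSn orbT.
have q01 : (1 < q 0)%N by rewrite qq0 leq_max orbT.
(* Truncation to [0, q 0) annihilates all blocks w k and keeps zs up to e. *)
have zF : `|zs| <= e + F j + n%:R * e.
  have W0 : zero_before (q 0) W.
    rewrite -[W]scale1r; apply: (zero_before_scaled_sum (x := w)) => k kn i iq.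
    have [+ _] := w_block k kn; apply; apply: (leq_trans iq).
    exact: (homo_leq leqnn (fun y x z => @leq_trans y x z) q_mono).
  pose P := space_chop (gtn (q 0)) : X -> X.
  have -> : zs = (zs - P zs) + (P (zs + T) - P (T - W)).
    apply: val_inj; apply/funext => k.
    rewrite [RHS](_ : _ = (val zs k - chop (gtn (q 0)) (val zs) k) +
      (chop (gtn (q 0)) (fun i => val zs i + val T i) k -
       chop (gtn (q 0)) (fun i => val T i - val W i) k)) //.
    by have := W0 k; rewrite /chop /=; case: ltnP => _; [move=> -> //|move=> _]; ring.
  rewrite -[leRHS]addrA; apply: (le_trans (ler_normD _ _)); apply: lerD.
    apply/bounded_by_norm.
    rewrite (_ : val _ = chop (leq (q 0)) (val zs)); first exact: (q1P _ q1q).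
    apply/funext => k; rewrite [LHS](_ : _ = val zs k - chop (gtn (q 0)) (val zs) k) //.
    by rewrite /chop /= ltnNge; case: leqP => _ /=; rewrite ?subrr ?subr0.
  apply: (le_trans (ler_normB _ _)); rewrite FE; apply: lerD.
    exact: norm_space_chop.
  exact: le_trans (norm_space_chop _ _) TW.
have W1 : `|W| <= F j + `|zs| + n%:R * e.
  have -> : W = (zs + T) - zs - (T - W) by rewrite [zs + T]addrC addrK subKr.
  apply: (le_trans (ler_normB _ _)); apply: lerD => //.
  by rewrite FE; exact: ler_normB.
have lamW : \sum_(i < n) lam i <= `|W| + 2 * n%:R * e.
  have := lower_blocks q_mono w_block q01 dq (fun k kn => (hP k kn).1).
  have : \sum_(k < n) (lam (nth ord0 s k) - e) <= \sum_(k < n) h k (val (w k)).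
    by apply: ler_sum => k _; exact: (hP k (ltn_ord k)).2.
  rewrite sumrB -(sum_reindex lam sP) sumr_const card_ord -[_ *+ n]mulr_natl.
  rewrite -/W; lra.
have MW : Mx <= `|W| + n%:R * e + 3 * e.
  apply: bigmax_le => [|i _].
    by rewrite !addr_ge0 // mulr_ge0 // ltW.
  pose k := index i s.
  have is_ : i \in s by rewrite (perm_mem sP) mem_enum.
  have kn : (k < n)%N by rewrite -ss index_mem.
  have Ei : nth ord0 s k = i by rewrite nth_index.
  have [_ [_ uwk Mk _ _]] := wP k kn; rewrite Ei in uwk Mk.
  have := block_le_sum q_mono w_block kn; rewrite -/W.
  have : `|u i (j i)| <= e + `|w k|.
    by rewrite -[u i (j i)](subrK (w k)); apply: (le_trans (ler_normD _ _)); rewrite lerD.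
  move: Mk; lra.
have L1 : F j <= L + e by move: jL; rewrite ler_distlC => /andP[]; lra.
have E0 : 0 <= n%:R * e by rewrite mulr_ge0 // ltW.
rewrite /size_estimate; move: zF W1 lamW MW L1 e0 E0.
set S := \sum_(i < n) lam i.
lra.
Qed.

End Family.

(** * Asymptotic symmetry and the main result *)

Section Final.
Variable R : realType.
Local Notation X := (avg_space R).

(** The coordinatewise limit along [U] satisfies the same bounds on all norming
    functionals as the sequence, hence is a vector of the space. *)
Lemma ultra_coord_cvg (U : set_system nat) (x : nat -> X) (B : R) :
  UltraFilter U -> (forall m, `|x m| <= B) ->
  exists z : X, forall k, val (x m - z) k @[m --> U] --> (0 : R).
Proof.
move=> UU xB; have UP : ProperFilter U by exact: ultra_proper.
have /choice[z zP] : forall k, exists r : R, val (x m) k @[m --> U] --> r.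
  move=> k; apply: (ultra_cvg (B := B)) => m.
  exact: le_trans (space_norm_coord _ _) (xB m).
have [Fatou _] := functionals_cvg UP zP.
have zb : norming_boundedb z.
  apply/asboolP; exists B => a b f fn.
  apply: (@closed_cvg _ _ U _ (fun m => `|f (val (x m))|) [set r | r <= B]).
  - exact: closed_le.
  - by apply: filterE => m; exact: le_trans (space_norm_ge _ fn) (xB m).
  - by apply: cvg_norm; exact: Fatou fn.
exists (AvgSpace zb) => k; rewrite -(subrr (z k)).
by apply: cvgB; [exact: zP|exact: cvg_cst].
Qed.

Lemma avg_space_asymptotically_symmetric : asymptotically_symmetric X.
Proof.
exists 11 => //.
case=> [|l] x sigma L L' xb F FL FL'.
  have e0 : enum 'I_0 = [::] by apply: size0nil; rewrite size_enum_ord.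
  move: FL FL'; rewrite e0 /= /F !big_ord0 normr0 => <- <-.
  by rewrite mulr0.
have [U [UU Uoo]] := ultraFilterLemma (_ : ProperFilter (\oo : set_system nat)).
have UP : ProperFilter U by exact: ultra_proper.
have /choice[B xB] : forall i, exists B, forall m, `|x i m| <= B.
  move=> i; have [M [_ HM]] := xb i; exists (M + 1) => m.
  by apply: (HM (M + 1)) => //; rewrite ltrDl.
have /choice[z zP] : forall i, exists z : X,
    forall k, val (x i m - z) k @[m --> U] --> (0 : R).
  by move=> i; exact: ultra_coord_cvg UU (xB i).
have uB i m : `|x i m - z i| <= B i + `|z i|.
  by apply: (le_trans (ler_normB _ _)); rewrite lerD2r.
have /choice[M uM] : forall i, exists M : R, `|x i m - z i| @[m --> U] --> M.
  by move=> i; apply: (ultra_cvg (B := B i + `|z i|)) => m; rewrite normr_id.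
have sP : perm_eq [seq sigma i | i <- enum 'I_l.+1] (enum 'I_l.+1).
  apply: uniq_perm; rewrite ?(map_inj_uniq perm_inj) ?enum_uniq // => i.
  rewrite mem_enum; apply/mapP; exists (sigma^-1 i)%g; rewrite ?mem_enum //.
  by rewrite permKV.
have := iterated_lim_ge UU Uoo zP uB uM sP FL'; apply: le_trans.
exact: (iterated_lim_le UU Uoo zP uB uM (perm_refl _) FL).
Qed.

End Final.

Theorem corollary4 (R : realType) :
  exists X : completeNormedModType R,
    [/\ infinite_dimensional [set: X],
        asymptotically_symmetric X &
        forall Y : set X, closed_subspace Y -> infinite_dimensional Y ->
          (forall p : R, 1 <= p -> ~ asymptotic_lp p Y) /\ ~ asymptotic_c0 Y].
Proof.
exists (avg_space R); split.
- exact: avg_space_infinite.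
- exact: avg_space_asymptotically_symmetric.
move=> Y _ Yinf; split; last exact: not_asymptotic_c0.
move=> p; rewrite le_eqVlt => /orP[/eqP <-|p1]; first exact: not_asymptotic_l1.
exact: not_asymptotic_lp.
Qed.
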